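(* Let $\mathcal{A}=(\mathcal{S}_1(\mathcal{H}),\boxtimes)$, where $\mathcal{H}=L^2(\mathbb{R}^\times,dt/|t|)$, and let $D:\mathcal{A}\to\mathcal{A}^*$ be the bounded linear map determined by $$D(\xi_1\otimes\eta_1)(\xi_0\otimes\eta_0)=\langle S\xi_1,R\overline{\xi_0}\rangle\,\langle R\overline{\eta_0},\eta_1\rangle .$$ Then $D$ is cyclic and weakly compact.
   Context: $\mathbb{R}^\times$ is the multiplicative group of non-zero reals with Haar measure $dt/|t|$; $\mathcal{H}=L^2(\mathbb{R}^\times,dt/|t|)$, with inner product linear in the first variable. $\overline{\mathcal{H}}$ is the conjugate Hilbert space; $\mathcal{H}\widehat{\otimes}\overline{\mathcal{H}}$ (projective tensor product) is identified with the trace-class operators $\mathcal{S}_1(\mathcal{H})$, with $\xi\otimes\eta$ corresponding to $\alpha\mapsto\langle\alpha,\eta\rangle\xi$. For $r\in\mathbb{R}^\times$, $(\lambda(r)\xi)(t)=\xi(r^{-1}t)$, and $f\cdot g$ is the pointwise product. Dual convolution $\boxtimes$ is the unique contractive bilinear map $\mathcal{S}_1(\mathcal{H})\times\mathcal{S}_1(\mathcal{H})\to\mathcal{S}_1(\mathcal{H})$ satisfying $$(\xi\otimes\eta)\boxtimes(\xi'\otimes\eta')=\int_{\mathbb{R}^\times}\bigl(\lambda(1+h)\xi\cdot\lambda(1+h^{-1})\xi'\bigr)\otimes\bigl(\lambda(1+h)\eta\cdot\lambda(1+h^{-1})\eta'\bigr)\,\frac{dh}{|h|}$$ (a Bochner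 integral); it makes $\mathcal{S}_1(\mathcal{H})$ into a commutative Banach algebra $\mathcal{A}$. For $\xi\in\mathcal{H}$, $(S\xi)(t)=\operatorname{sgn}(t)\xi(t)$ with $\operatorname{sgn}(t)=t/|t|$, and $(R\xi)(t)=\xi(-t)$; $\overline{\xi}$ denotes the pointwise complex conjugate. A map $D:\mathcal{A}\to\mathcal{A}^*$ is called cyclic if $D(a)(b)=-D(b)(a)$ for all $a,b\in\mathcal{A}$. *)

(* Defs.v *)
From HB Require Import structures.
From mathcomp Require Import all_boot all_order all_algebra.
From mathcomp Require Import complex.
From mathcomp Require Import all_classical all_reals all_analysis.
From mathcomp Require Import measurable_realfun.

Set Implicit Arguments.
Unset Strict Implicit.
Unset Printing Implicit Defensive.

Import Order.TTheory GRing.Theory Num.Theory.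
Import numFieldNormedType.Exports.

Local Open Scope classical_set_scope.
Local Open Scope ring_scope.
Local Open Scope complex_scope.
Local Open Scope quotient_scope.

HB.instance Definition _ (R : realType) := NormedModule.copy R[i] R[i]^o.

(* The norm of a normed module over R[i] is R[i]-valued; this is the same
   number as an element of R. *)
Definition rnorm (R : realType) (V : normedModType R[i]) (x : V) : R :=
  complex.Re `|x|.

Section rnorm_theory.
Context (R : realType) (V : normedModType R[i]).
Implicit Types (x y : V) (c : R[i]).

Lemma rnormE x : `|x| = (rnorm x)%:C.
Proof.
have := ger0_Im (normr_ge0 x); rewrite /rnorm.
by case: `|x| => a b /= ->.
Qed.

Lemma rnorm_ge0 x : 0 <= rnorm x.
Proof. by rewrite -lecR -rnormE; exact: normr_ge0. Qed.

Lemma rnormD x y : rnorm (x + y) <= rnorm x + rnorm y.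
Proof. by rewrite -lecR rmorphD /= -!rnormE ler_normD. Qed.

Lemma rnormZ c x : rnorm (c *: x) = Normc.normc c * rnorm x.
Proof.
by apply: (@complexI R); rewrite rmorphM /= -!rnormE normrZ.
Qed.

Lemma rnorm0 : rnorm (0 : V) = 0.
Proof. by rewrite /rnorm normr0. Qed.

Lemma rnorm_eq0 x : rnorm x = 0 -> x = 0.
Proof. by move=> x0; apply/eqP; rewrite -normr_eq0 rnormE x0. Qed.

Lemma ler_dist_rnorm x y : `|rnorm x - rnorm y| <= rnorm (x - y).
Proof.
have h (u v : V) : rnorm u - rnorm v <= rnorm (u - v).
  by rewrite lerBlDr; have := rnormD (u - v) v; rewrite subrK.
rewrite ler_norml h andbT lerNl opprB.
by rewrite (le_trans (h _ _))// /rnorm distrC.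
Qed.

Lemma cvg_rnorm (I : Type) (F : set_system I) (FF : Filter F) (u : I -> V) x :
  u @ F --> x -> (fun i => rnorm (u i)) @ F --> rnorm x.
Proof.
move=> ux; apply/cvgrPdist_lt => e e0.
have e0' : 0 < e%:C by rewrite ltcR.
have /cvgrPdist_lt/(_ _ e0') := ux.
apply: filterS => i; rewrite rnormE ltcR.
exact: le_lt_trans (ler_dist_rnorm _ _).
Qed.

End rnorm_theory.

Section normc.
Context (R : realType).
Implicit Types (a b : R) (z : R[i]).

Lemma normc_ge0 z : 0 <= Normc.normc z.
Proof. by case: z => a b; exact: sqrtr_ge0. Qed.

Lemma normc_conjc z : Normc.normc (conjc z) = Normc.normc z.
Proof. by case: z => a b /=; rewrite sqrrN. Qed.

Lemma Re_le_normc z : `|complex.Re z| <= Normc.normc z.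
Proof.
case: z => a b /=; rewrite -sqrtr_sqr ler_wsqrtr//.
by rewrite lerDl sqr_ge0.
Qed.

Lemma Im_le_normc z : `|complex.Im z| <= Normc.normc z.
Proof.
case: z => a b /=; rewrite -sqrtr_sqr ler_wsqrtr//.
by rewrite lerDr sqr_ge0.
Qed.

Lemma normc_le a b : Normc.normc (a +i* b) <= `|a| + `|b|.
Proof.
rewrite /= -[leRHS]ger0_norm ?addr_ge0// -sqrtr_sqr ler_wsqrtr//.
rewrite sqrrD !real_normK ?num_real// addrAC lerDl.
by rewrite mulrn_wge0// mulr_ge0.
Qed.

End normc.

Section L2.
Context d (T : measurableType d) (R : realType).
Variable mu : {measure set T -> \bar R}.
Implicit Types f g : T -> R[i].

Let measurableT_comp_powR (h : T -> R) p :
  measurable_fun setT h -> measurable_fun setT (fun x => h x `^ p).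
Proof. exact: (@measurableT_comp _ _ _ _ _ _ (@powR R ^~ p)). Qed.

Definition cmeasurable f : Prop :=
  measurable_fun setT (fun t => complex.Re (f t)) /\
  measurable_fun setT (fun t => complex.Im (f t)).

Definition cintegral f : R[i] :=
  (\int[mu]_t complex.Re (f t)) +i* (\int[mu]_t complex.Im (f t)).

Definition L2norm f : \bar R :=
  'N[mu]_2%:E[EFin \o (fun t => Normc.normc (f t))]%E.

Definition square_integrable f : Prop := cmeasurable f /\ (L2norm f < +oo)%E.

Lemma cmeasurable_normc f : cmeasurable f ->
  measurable_fun setT (fun t => Normc.normc (f t)).
Proof.
move=> [mr mi].
have -> : (fun t => Normc.normc (f t)) =
  (fun t => Num.sqrt (complex.Re (f t) ^+ 2 + complex.Im (f t) ^+ 2)).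
  by apply/funext => t; case: (f t).
apply: (@measurableT_comp _ _ _ _ _ _ (@Num.sqrt R)).
  apply: continuous_measurable_fun.
  exact: sqrt_continuous.
by apply: measurable_funD; apply: measurable_funX.
Qed.

Lemma cmeasurableD f g : cmeasurable f -> cmeasurable g ->
  cmeasurable (fun t => f t + g t).
Proof.
move=> [fr fi] [gr gi]; split.
  rewrite (_ : (fun _ => _) =
    (fun t => complex.Re (f t) + complex.Re (g t))); last first.
    by apply/funext => t; case: (f t) (g t) => [? ?] [? ?].
  exact: measurable_funD.
rewrite (_ : (fun _ => _) =
  (fun t => complex.Im (f t) + complex.Im (g t))); last first.
  by apply/funext => t; case: (f t) (g t) => [? ?] [? ?].
exact: measurable_funD.
Qed.

Lemma cmeasurableZ c f : cmeasurable f -> cmeasurable (fun t => c * f t).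
Proof.
move: c => [a b] [fr fi]; split.
  rewrite (_ : (fun _ => _) =
    (fun t => a * complex.Re (f t) - b * complex.Im (f t))); last first.
    by apply/funext => t; case: (f t).
  by apply: measurable_funB; apply: measurable_funM.
rewrite (_ : (fun _ => _) =
  (fun t => a * complex.Im (f t) + b * complex.Re (f t))); last first.
  by apply/funext => t; case: (f t) => ? ?.
by apply: measurable_funD; apply: measurable_funM.
Qed.

Lemma cmeasurableM f g : cmeasurable f -> cmeasurable g ->
  cmeasurable (fun t => f t * g t).
Proof.
move=> [fr fi] [gr gi]; split.
  rewrite (_ : (fun _ => _) = (fun t => complex.Re (f t) * complex.Re (g t)
    - complex.Im (f t) * complex.Im (g t))); last first.
    by apply/funext => t; case: (f t) (g t) => [? ?] [? ?].
  by apply: measurable_funB; apply: measurable_funM.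
rewrite (_ : (fun _ => _) = (fun t => complex.Re (f t) * complex.Im (g t)
  + complex.Im (f t) * complex.Re (g t))); last first.
  by apply/funext => t; case: (f t) (g t) => [? ?] [? ?].
by apply: measurable_funD; apply: measurable_funM.
Qed.

Lemma cmeasurable_conjc f : cmeasurable f -> cmeasurable (fun t => conjc (f t)).
Proof.
move=> [fr fi]; split.
  rewrite (_ : (fun _ => _) = (fun t => complex.Re (f t)))//.
  by apply/funext => t; case: (f t).
rewrite (_ : (fun _ => _) = (fun t => - complex.Im (f t))).
  exact: measurable_funN.
by apply/funext => t; case: (f t).
Qed.

Lemma Lnorm2E (h : T -> R) : 'N[mu]_2%:E[EFin \o h]%E =
  ((\int[mu]_x (`|h x| `^ 2)%:E) `^ 2^-1)%E.
Proof.
by rewrite unlock; congr poweR; apply: eq_integral => x _ /=.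
Qed.

Lemma L2norm_le f (h : T -> R) : measurable_fun setT h ->
  cmeasurable f -> (forall t, Normc.normc (f t) <= h t) ->
  (L2norm f <= 'N[mu]_2%:E[EFin \o h])%E.
Proof.
move=> mh mf fh; rewrite /L2norm !Lnorm2E.
apply: gt0_ler_poweR.
- by rewrite invr_ge0.
- by rewrite in_itv/= leey andbT integral_ge0// => x _;
    rewrite lee_fin powR_ge0.
- by rewrite in_itv/= leey andbT integral_ge0// => x _;
    rewrite lee_fin powR_ge0.
apply: ge0_le_integral => //=.
- apply/measurable_EFinP; apply: measurableT_comp_powR.
  by apply: measurableT_comp => //; exact: cmeasurable_normc.
- apply/measurable_EFinP; apply: measurableT_comp_powR.
  exact: measurableT_comp.
- move=> x _; rewrite lee_fin ge0_ler_powR// ?nnegrE//.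
  rewrite !ger0_norm//; last first.
    by case: (f x) => a b; exact: sqrtr_ge0.
  by rewrite (le_trans _ (fh x))//; case: (f x) => a b; exact: sqrtr_ge0.
Qed.

Lemma L2normD f g : cmeasurable f -> cmeasurable g ->
  (L2norm (fun t => f t + g t)%R <= L2norm f + L2norm g)%E.
Proof.
move=> mf mg.
apply: (@le_trans _ _ ('N[mu]_2%:E[EFin \o
  ((fun t => Normc.normc (f t)) \+ (fun t => Normc.normc (g t)))%R])%E).
  apply: L2norm_le.
  - by apply: measurable_funD; exact: cmeasurable_normc.
  - exact: cmeasurableD.
  - by move=> t; exact: le_normcD.
by apply: minkowski_EFin; rewrite ?ler1n//; exact: cmeasurable_normc.
Qed.

Lemma L2normZ c f : square_integrable f ->
  L2norm (fun t => c * f t) = ((Normc.normc c)%:E * L2norm f)%E.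
Proof.
move=> [mf foo]; pose g t := Normc.normc (f t).
have gL : g \in Lfun mu 2%:E.
  rewrite inE; apply/andP; split; rewrite inE//=.
  exact: cmeasurable_normc.
have := LnormZ (Lfun_Sub (lee1n 2) gL) (Normc.normc c).
rewrite Lfun_valP ger0_norm ?normc_ge0// => <-; rewrite /L2norm.
by apply: eq_Lnorm => t /=; rewrite Normc.normcM.
Qed.

Lemma square_integrable0 : square_integrable (fun=> 0).
Proof.
split; first by split; exact: measurable_cst.
rewrite /L2norm (_ : EFin \o _ = cst 0%E) ?Lnorm0 ?ltry//.
by apply/funext => t /=; congr EFin; exact: Normc.normc0.
Qed.

Lemma square_integrableD f g : square_integrable f -> square_integrable g ->
  square_integrable (fun t => f t + g t).
Proof.
move=> [mf foo] [mg goo]; split; first exact: cmeasurableD.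
by apply: (le_lt_trans (L2normD mf mg)); rewrite lte_add_pinfty.
Qed.

Lemma square_integrableZ c f : square_integrable f ->
  square_integrable (fun t => c * f t).
Proof.
move=> fi; split; first by apply: cmeasurableZ; case: fi.
rewrite L2normZ// lte_mul_pinfty ?lee_fin ?normc_ge0//.
by case: fi.
Qed.

Lemma L2norm_ae f g : cmeasurable f -> cmeasurable g ->
  f = g %[ae mu] -> L2norm f = L2norm g.
Proof.
move=> mf mg fg; rewrite /L2norm !Lnorm2E; congr poweR.
apply: ae_eq_integral => //.
- apply/measurable_EFinP; apply: measurableT_comp_powR.
  by apply: measurableT_comp => //; exact: cmeasurable_normc.
- apply/measurable_EFinP; apply: measurableT_comp_powR.
  by apply: measurableT_comp => //; exact: cmeasurable_normc.
by apply: filterS fg => t /(_ I) ft _; rewrite ft.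
Qed.

Lemma L2norm_eq0 f : cmeasurable f -> L2norm f = 0%E -> f = cst 0 %[ae mu].
Proof.
move=> mf /Lnorm_eq0_eq0.
have m : measurable_fun setT (fun t => (Normc.normc (f t))%:E).
  by apply/measurable_EFinP; exact: cmeasurable_normc.
move=> /(_ m) /(_ ltac:(by [])); apply: filterS => t /(_ I) [ft] _.
exact: Normc.eq0_normc.
Qed.

End L2.

Section l2fun.
Context d (T : measurableType d) (R : realType).
Variable mu : {measure set T -> \bar R}.

Definition l2 : {pred (T -> R[i])} := fun f => `[< square_integrable mu f >].

Lemma l2_submod_closed : submod_closed l2.
Proof.
split; first by apply/asboolP; exact: square_integrable0.
move=> c f g /asboolP fi /asboolP gi; apply/asboolP.
apply: (@square_integrableD _ _ _ mu (fun t => c * f t) g) => //.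
exact: square_integrableZ.
Qed.

HB.instance Definition _ := GRing.isSubmodClosed.Build R[i] (T -> R[i]) l2
  l2_submod_closed.

Record l2fun := L2Fun { l2val :> T -> R[i]; l2valP : l2val \in l2 }.

HB.instance Definition _ := [isSub for l2val].
HB.instance Definition _ := [Choice of l2fun by <:].
HB.instance Definition _ := [SubChoice_isSubLmodule of l2fun by <:].

Lemma l2fun_square_integrable (f : l2fun) : square_integrable mu f.
Proof. by apply/asboolP; exact: (l2valP f). Qed.

Definition l2_eqv (f g : l2fun) := `[< l2val f = l2val g %[ae mu] >].

Lemma l2_eqv_refl : reflexive l2_eqv.
Proof. by move=> f; apply/asboolP; exact: ae_eq_refl. Qed.

Lemma l2_eqv_sym : symmetric l2_eqv.
Proof. by move=> f g; apply/asboolP/asboolP; exact: ae_eq_sym. Qed.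

Lemma l2_eqv_trans : transitive l2_eqv.
Proof.
move=> f g h /asboolP gf /asboolP fh; apply/asboolP.
exact: ae_eq_trans gf fh.
Qed.

Canonical l2_eqv_canonical :=
  EquivRel l2_eqv l2_eqv_refl l2_eqv_sym l2_eqv_trans.

(* The complex Hilbert space L^2(mu): square-integrable functions modulo
   equality almost everywhere. *)
Definition L2 : Type := {eq_quot l2_eqv}.
HB.instance Definition _ := Choice.on L2.
HB.instance Definition _ := EqQuotient.on L2.

Definition L2repr (x : L2) : T -> R[i] := l2val (repr x).
Coercion L2repr : L2 >-> Funclass.

Lemma L2pi_eq (f g : l2fun) :
  l2val f = l2val g %[ae mu] -> \pi_L2 f = \pi_L2 g.
Proof. by move=> fg; apply/eqmodP/asboolP. Qed.

Lemma L2reprK (f : l2fun) : l2val (repr (\pi_L2 f)) = l2val f %[ae mu].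
Proof.
have /asboolP// : l2_eqv (repr (\pi_L2 f)) f.
by apply/(@eqquotP _ _ L2); rewrite reprK.
Qed.

Lemma L2repr_square_integrable (x : L2) : square_integrable mu x.
Proof. exact: l2fun_square_integrable. Qed.

Definition L2_add (x y : L2) : L2 := \pi_L2 (repr x + repr y).
Definition L2_opp (x : L2) : L2 := \pi_L2 (- repr x).
Definition L2_scale (c : R[i]) (x : L2) : L2 := \pi_L2 (c *: repr x).

Let addE f g : L2_add (\pi_L2 f) (\pi_L2 g) = \pi_L2 (f + g).
Proof.
apply: L2pi_eq; move: (L2reprK f) (L2reprK g).
apply: filterS2 => t /(_ I) ft /(_ I) gt _.
by rewrite -[LHS]/(l2val _ t + l2val _ t) ft gt.
Qed.

Let oppE f : L2_opp (\pi_L2 f) = \pi_L2 (- f).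
Proof.
apply: L2pi_eq; move: (L2reprK f); apply: filterS => t /(_ I) ft _.
by rewrite -[LHS]/(- l2val _ t) ft.
Qed.

Let scaleE c f : L2_scale c (\pi_L2 f) = \pi_L2 (c *: f).
Proof.
apply: L2pi_eq; move: (L2reprK f); apply: filterS => t /(_ I) ft _.
by rewrite -[LHS]/(c * l2val _ t) ft.
Qed.

Let addA : associative L2_add.
Proof.
by elim/quotW=> f; elim/quotW=> g; elim/quotW=> h; 
  rewrite (addE g h) (addE f g) !addE addrA.
Qed.

Let addC : commutative L2_add.
Proof. by elim/quotW=> f; elim/quotW=> g; rewrite !addE addrC. Qed.

Let add0 : left_id (\pi_L2 0) L2_add.
Proof. by elim/quotW=> f; rewrite !addE add0r. Qed.

Let addN : left_inverse (\pi_L2 0) L2_opp L2_add.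
Proof. by elim/quotW=> f; rewrite oppE addE addNr. Qed.

HB.instance Definition _ := GRing.isZmodule.Build L2 addA addC add0 addN.

Let scaleA a b x : L2_scale a (L2_scale b x) = L2_scale (a * b) x.
Proof. by elim/quotW: x => f; rewrite (scaleE b) !scaleE scalerA. Qed.

Let scale1 : left_id 1 L2_scale.
Proof. by elim/quotW=> f; rewrite scaleE scale1r. Qed.

Let scaleDr : right_distributive L2_scale +%R.
Proof.
move=> a; elim/quotW=> f; elim/quotW=> g.
rewrite -[LHS]/(L2_scale a (L2_add _ _)) -[RHS]/(L2_add _ _) !(addE, scaleE).
by rewrite -scalerDr.
Qed.

Let scaleDl x : {morph L2_scale^~ x : a b / a + b}.
Proof.
by elim/quotW: x => f a b; rewrite !scaleE scalerDl -addE.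
Qed.

HB.instance Definition _ := GRing.Zmodule_isLmodule.Build R[i] L2
  scaleA scale1 scaleDr scaleDl.

Lemma L2pi0 : \pi_L2 0 = 0 :> L2. Proof. by []. Qed.

Lemma L2piD f g : \pi_L2 (f + g) = \pi_L2 f + \pi_L2 g.
Proof. by rewrite -addE. Qed.

Lemma L2piZ c f : \pi_L2 (c *: f) = c *: \pi_L2 f.
Proof. by rewrite -scaleE. Qed.

Definition L2rnorm (x : L2) : R := fine (L2norm mu x).

Lemma L2norm_fin_num (f : T -> R[i]) : square_integrable mu f ->
  L2norm mu f \is a fin_num.
Proof. by move=> [_ foo]; rewrite ge0_fin_numE// Lnorm_ge0. Qed.

Lemma L2rnorm_pi f : L2rnorm (\pi_L2 f) = fine (L2norm mu f).
Proof.
rewrite /L2rnorm; congr fine; apply: L2norm_ae; last exact: L2reprK.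
- by case: (L2repr_square_integrable (\pi_L2 f)).
- by case: (l2fun_square_integrable f).
Qed.

Lemma L2rnormD x y : L2rnorm (x + y) <= L2rnorm x + L2rnorm y.
Proof.
elim/quotW: x => f; elim/quotW: y => g; rewrite -L2piD !L2rnorm_pi.
have [fi gi] := (l2fun_square_integrable f, l2fun_square_integrable g).
have fgi := l2fun_square_integrable (f + g).
rewrite -lee_fin EFinD !fineK ?L2norm_fin_num//.
by apply: L2normD; [case: fi|case: gi].
Qed.

Lemma L2rnormZ c x : L2rnorm (c *: x) = Normc.normc c * L2rnorm x.
Proof.
elim/quotW: x => f; rewrite -L2piZ !L2rnorm_pi.
have fi := l2fun_square_integrable f.
by have := L2normZ c fi => /= ->; rewrite fineM ?L2norm_fin_num.
Qed.

Lemma L2rnorm_eq0 x : L2rnorm x = 0 -> x = 0.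
Proof.
elim/quotW: x => f; rewrite L2rnorm_pi => f0.
have fi := l2fun_square_integrable f.
apply: L2pi_eq; apply: L2norm_eq0; first by case: fi.
by rewrite -[LHS]fineK ?L2norm_fin_num// f0.
Qed.

Let norm_ (x : L2) : R[i] := (L2rnorm x)%:C.

Let norm_D x y : norm_ (x + y) <= norm_ x + norm_ y.
Proof. by rewrite -rmorphD lecR L2rnormD. Qed.

Let norm_Z c x : norm_ (c *: x) = `|c| * norm_ x.
Proof. by rewrite /norm_ L2rnormZ rmorphM. Qed.

Let norm_eq0 x : norm_ x = 0 -> x = 0.
Proof. by move=> /complexI; exact: L2rnorm_eq0. Qed.

HB.instance Definition _ :=
  Lmodule_isNormed.Build R[i] L2 norm_D norm_Z norm_eq0.

Lemma L2_rnormE (x : L2) : rnorm x = fine (L2norm mu x).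
Proof. by []. Qed.

(* The inner product is linear in the first variable. *)
Definition inner (x y : L2) : R[i] := cintegral mu (fun t => x t * conjc (y t)).

(* The class of f; a function that is not square-integrable is sent to 0. *)
Definition L2_of (f : T -> R[i]) : L2 := \pi_L2 (insubd (0 : l2fun) f).

Let part (x y : L2) (k : T -> R) : measurable_fun setT k ->
  (forall t, `|k t| <= Normc.normc (x t) * Normc.normc (y t)) ->
  `|\int[mu]_t k t| <= rnorm x * rnorm y.
Proof.
move=> mk kh.
have [[mx xoo] [my yoo]] :=
  (L2repr_square_integrable x, L2repr_square_integrable y).
have mnx := cmeasurable_normc mx; have mny := cmeasurable_normc my.
pose h t := Normc.normc (x t) * Normc.normc (y t).
have mh : measurable_fun setT h by exact: measurable_funM.
have h0 t : 0 <= h t by rewrite mulr_ge0 ?normc_ge0.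
have hh : (\int[mu]_t (h t)%:E <= (rnorm x * rnorm y)%:E)%E.
  have two0 : 0 < 2 :> R by [].
  have half2 : 2^-1 + 2^-1 = 1 :> R by rewrite -div1r -splitr.
  have := @hoelder _ _ _ mu _ _ 2 2 mnx mny two0 two0 half2.
  rewrite Lnorm1 EFinM !L2_rnormE !fineK ?L2norm_fin_num//.
  by under eq_integral do rewrite /= ger0_norm ?h0//.
have kle : (\int[mu]_t `|k t|%:E <= (rnorm x * rnorm y)%:E)%E.
  apply: le_trans hh; apply: ge0_le_integral => //=.
  - by apply/measurable_EFinP; exact: measurableT_comp.
  - exact/measurable_EFinP.
  - by move=> t _; rewrite lee_fin; exact: kh.
have ki : mu.-integrable setT (EFin \o k).
  apply/integrableP; split; first exact/measurable_EFinP.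
  exact: le_lt_trans kle (ltry _).
apply: le_trans (le_normr_Rintegral _ ki) _ => //.
rewrite -lee_fin fineK// ge0_fin_numE ?integral_ge0//.
exact: le_lt_trans kle (ltry _).
Qed.

Lemma inner_bound (x y : L2) :
  Normc.normc (inner x y) <= 2 * (rnorm x * rnorm y).
Proof.
have [[mx _] [my _]] :=
  (L2repr_square_integrable x, L2repr_square_integrable y).
have [mr mi] := cmeasurableM mx (cmeasurable_conjc my).
rewrite /inner /cintegral mulr2n mulrDl mul1r.
apply: le_trans (normc_le _ _) _; apply: lerD; apply: part => // t.
  by rewrite -(normc_conjc (y t)) -Normc.normcM Re_le_normc.
by rewrite -(normc_conjc (y t)) -Normc.normcM Im_le_normc.
Qed.

End l2fun.

Section dual.
Context (R : realType) (V : normedModType R[i]).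

Definition bounded_functional : {pred (V -> R[i])} :=
  fun phi => `[< scalar phi /\ continuous phi >].

Lemma bounded_functional_submod_closed : submod_closed bounded_functional.
Proof.
split.
  apply/asboolP; split; last by move=> x; exact: cvg_cst.
  by move=> c x y; rewrite /= mulr0 addr0.
move=> c f g /asboolP[lf cf] /asboolP[lg cg]; apply/asboolP; split.
  move=> b x y; rewrite -![(c *: f + g) _]/(c * f _ + g _) lf lg.
  by rewrite !mulrDr !mulrA (mulrC c b) -!addrA; congr (_ + _); rewrite addrCA.
move=> x; apply: cvgD; last exact: cg.
by apply: cvgZr; exact: cf.
Qed.

HB.instance Definition _ := GRing.isSubmodClosed.Build R[i] (V -> R[i])
  bounded_functional bounded_functional_submod_closed.

(* The Banach dual: bounded linear functionals, with the operator norm. *)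
Record dual := Dual {
  dual_val :> V -> R[i]; dual_valP : dual_val \in bounded_functional }.

HB.instance Definition _ := [isSub for dual_val].
HB.instance Definition _ := [Choice of dual by <:].
HB.instance Definition _ := [SubChoice_isSubLmodule of dual by <:].

Lemma dual_scalar (phi : dual) : scalar phi.
Proof. by have /asboolP[] := dual_valP phi. Qed.

Lemma dual_continuous (phi : dual) : continuous phi.
Proof. by have /asboolP[] := dual_valP phi. Qed.

Lemma dual0 (phi : dual) : phi 0 = 0.
Proof.
have := dual_scalar phi 1 0 0; rewrite scale1r mul1r addr0 => /eqP.
by rewrite -subr_eq subrr eq_sym => /eqP.
Qed.

Lemma dualZ (phi : dual) c x : phi (c *: x) = c * phi x.
Proof. by have := dual_scalar phi c x 0; rewrite !addr0 dual0 addr0. Qed.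

Lemma dual_bounded (phi : dual) :
  exists2 M : R, 0 <= M & forall x, rnorm (phi x) <= M * rnorm x.
Proof.
pose f : {linear V -> R[i]} :=
  HB.pack (phi : V -> R[i]) (GRing.isLinear.Build _ _ _ _ _ (dual_scalar phi)).
have /linear_boundedP : bounded_near f (nbhs (0 : V)).
  by apply: continuous_linear_bounded; exact: dual_continuous.
move=> [M [Mreal Mf]].
exists (`|complex.Re M| + 1); first by rewrite addr_ge0.
move=> x; rewrite -lecR rmorphM/= -!rnormE; apply: Mf.
have -> : M = (complex.Re M)%:C by rewrite RRe_real.
by rewrite ltcR/= (le_lt_trans (ler_norm _))// ltrDl.
Qed.

Definition dual_rnorm (phi : dual) : R :=
  sup [set rnorm (phi x) | x in [set x : V | `|x| <= 1]].

Let dset (phi : dual) := [set rnorm (phi x) | x in [set x : V | `|x| <= 1]].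

Let dset_has_sup phi : has_sup (dset phi).
Proof.
split; first by exists (rnorm (phi 0)), 0 => //=; rewrite normr0 ler01.
have [M M0 Mphi] := dual_bounded phi.
exists M => _ [x /= x1 <-]; apply: le_trans (Mphi x) _.
by rewrite ler_piMr// -lecR -rnormE.
Qed.

Lemma dual_rnorm_ub (phi : dual) x :
  `|x| <= 1 -> rnorm (phi x) <= dual_rnorm phi.
Proof.
by move=> x1; apply: ub_le_sup; [have [] := dset_has_sup phi|exists x].
Qed.

Lemma dual_rnorm_le (phi : dual) M :
  (forall x, `|x| <= 1 -> rnorm (phi x) <= M) ->
  dual_rnorm phi <= M.
Proof.
move=> phiM; apply: ge_sup; first by have [] := dset_has_sup phi.
by move=> _ [x /= x1 <-]; exact: phiM.
Qed.

Lemma dual_rnormD (phi psi : dual) :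
  dual_rnorm (phi + psi) <= dual_rnorm phi + dual_rnorm psi.
Proof.
apply: dual_rnorm_le => x x1; rewrite -[(phi + psi) x]/(phi x + psi x).
by rewrite (le_trans (rnormD _ _))// lerD// dual_rnorm_ub.
Qed.

Let dual_rnormZ_le c (phi : dual) :
  dual_rnorm (c *: phi) <= Normc.normc c * dual_rnorm phi.
Proof.
apply: dual_rnorm_le => x x1; rewrite -[(c *: phi) x]/(c *: phi x).
by rewrite rnormZ ler_wpM2l ?normc_ge0// dual_rnorm_ub.
Qed.

Lemma dual_rnormZ c (phi : dual) :
  dual_rnorm (c *: phi) = Normc.normc c * dual_rnorm phi.
Proof.
apply/eqP; rewrite eq_le dual_rnormZ_le/=.
have [->|c0] := eqVneq c 0.
  rewrite scale0r Normc.normc0 mul0r.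
  apply: le_trans (dual_rnorm_ub 0 (_ : `|0| <= 1)).
    exact: rnorm_ge0.
  by rewrite normr0 ler01.
have nc0 : 0 < Normc.normc c.
  rewrite lt_def normc_ge0 andbT.
  by apply: contra c0 => /eqP /Normc.eq0_normc ->.
have := dual_rnormZ_le c^-1 (c *: phi).
by rewrite scalerA mulVf// scale1r Normc.normcV ler_pdivlMl.
Qed.

Lemma dual_rnorm_eq0 (phi : dual) : dual_rnorm phi = 0 -> phi = 0.
Proof.
move=> phi0; apply/val_inj/funext => x /=.
have [->|x0] := eqVneq x 0; first by rewrite dual0.
have nx0 : `|x| != 0 by rewrite normr_eq0.
apply: (@rnorm_eq0 R R[i]); apply/eqP; rewrite eq_le rnorm_ge0 andbT.
have : rnorm (phi (`|x|^-1 *: x)) <= 0.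
  rewrite -phi0 dual_rnorm_ub// normrZ normfV normr_id mulVf//.
rewrite dualZ rnormZ pmulr_rle0//.
rewrite lt_def normc_ge0 andbT; apply/eqP => /Normc.eq0_normc /eqP.
by rewrite invr_eq0 (negPf nx0).
Qed.

Let norm_ (phi : dual) : R[i] := (dual_rnorm phi)%:C.

Let norm_D x y : norm_ (x + y) <= norm_ x + norm_ y.
Proof. by rewrite -rmorphD lecR dual_rnormD. Qed.

Let norm_Z c x : norm_ (c *: x) = `|c| * norm_ x.
Proof. by rewrite /norm_ dual_rnormZ rmorphM. Qed.

Let norm_eq0 x : norm_ x = 0 -> x = 0.
Proof. by move=> /complexI; exact: dual_rnorm_eq0. Qed.

HB.instance Definition _ :=
  Lmodule_isNormed.Build R[i] dual norm_D norm_Z norm_eq0.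

End dual.

(* V with its weak topology, the initial topology for the functionals in the
   dual of V. *)
Definition weak (R : realType) (V : normedModType R[i]) : Type :=
  initial_topology
    (fun x : V => (fun phi : dual V => phi x) : prod_topology (fun=> R[i])).
HB.instance Definition _ (R : realType) (V : normedModType R[i]) :=
  Topological.copy (weak V) (initial_topology
    (fun x : V => (fun phi : dual V => phi x) : prod_topology (fun=> R[i]))).

Definition weakly_compact (R : realType) (V W : normedModType R[i])
    (f : V -> W) : Prop :=
  precompact (f @` [set x : V | `|x| <= 1] : set (weak W)).

Section interleave.

Definition interleave (X : Type) (u v : nat -> X) : nat -> X :=
  fun n => if odd n then v n./2 else u n./2.

Lemma series_interleave (V : zmodType) (u v : nat -> V) n :
  series (interleave u v) n = series u (uphalf n) + series v n./2.
Proof.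
elim: n => [|n IHn]; first by rewrite !seriesEnat /= !big_geq ?addr0.
rewrite seriesSr IHn /interleave -[uphalf n.+1]/(n./2.+1).
rewrite -[n.+1./2]/(uphalf n) uphalf_half.
have [_|_] := boolP (odd n); first by rewrite add1n (seriesSr v) addrA.
by rewrite add0n (seriesSr u) addrAC.
Qed.

Lemma cvg_half : (fun n => n./2) @ \oo --> \oo.
Proof.
apply/cvgnyPge => M; near=> n.
rewrite -(doubleK M); apply: half_leq; near: n; exact: nbhs_infty_ge.
Unshelve. all: by end_near. Qed.

Lemma cvg_uphalf : (fun n => uphalf n) @ \oo --> \oo.
Proof.
apply/cvgnyPge => M; near=> n.
rewrite uphalfE -(doubleK M); apply: half_leq; apply: leqW; near: n.
exact: nbhs_infty_ge.
Unshelve. all: by end_near. Qed.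

Lemma cvg_series_interleave (K : numFieldType) (V : normedModType K)
    (u v : nat -> V) (a b : V) :
  series u @ \oo --> a -> series v @ \oo --> b ->
  series (interleave u v) @ \oo --> a + b.
Proof.
move=> ua vb.
rewrite (_ : series _ = (series u \o uphalf) \+ (series v \o half)); last first.
  by apply/funext => n; rewrite series_interleave.
apply: cvgD.
  by apply: (cvg_comp _ _ cvg_uphalf); exact: ua.
by apply: (cvg_comp _ _ cvg_half); exact: vb.
Qed.

End interleave.

Section trace_class.
Context d (T : measurableType d) (R : realType).
Variable mu : {measure set T -> \bar R}.
Local Notation H := (L2 mu).

Definition rank_one (x y : H) : H -> H := fun z => inner z y *: x.

(* a is the sum of the operators x_n (x) y_n, and s = sum_n |x_n| |y_n|. *)
Definition represents (x y : nat -> H) (a : H -> H) (s : R) : Prop :=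
  (series (fun n => rnorm (x n) * rnorm (y n)) @ \oo --> s) /\
  (forall z, series (fun n => rank_one (x n) (y n) z) @ \oo --> a z).

Definition is_trace_class : {pred (H -> H)} :=
  fun a => `[< exists x y s, represents x y a s >].

Lemma represents0 : represents (fun=> 0) (fun=> 0) 0 0.
Proof.
split.
  rewrite (_ : series _ = cst 0); first exact: cvg_cst.
  apply/funext => n; rewrite seriesEnat/= big1// => i _.
  by rewrite rnorm0 mul0r.
move=> z.
rewrite (_ : series _ = cst 0); first exact: cvg_cst.
apply/funext => n; rewrite seriesEnat/= big1// => i _.
by rewrite /rank_one scaler0.
Qed.

Lemma representsZ c x y a s : represents x y a s ->
  represents (fun n => c *: x n) y (c *: a) (Normc.normc c * s).
Proof.
move=> [xys xya]; split.
  rewrite (_ : series _ = (fun n =>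
    Normc.normc c * series (fun n => rnorm (x n) * rnorm (y n)) n)).
    by apply: cvgMr; exact: xys.
  apply/funext => n; rewrite !seriesEnat/= mulr_sumr.
  by apply: eq_bigr => i _; rewrite rnormZ mulrA.
move=> z.
rewrite (_ : series _ = (fun n =>
    c *: series (fun n => rank_one (x n) (y n) z) n)).
  by apply: cvgZr; exact: xya.
apply/funext => n; rewrite !seriesEnat/= scaler_sumr.
by apply: eq_bigr => i _; rewrite /rank_one !scalerA mulrC.
Qed.

Lemma representsD x y a s x' y' a' s' :
  represents x y a s -> represents x' y' a' s' ->
  represents (interleave x x') (interleave y y') (a + a') (s + s').
Proof.
move=> [xys xya] [xys' xya']; split.
  rewrite (_ : (fun n => _) = interleave (fun n => rnorm (x n) * rnorm (y n))
    (fun n => rnorm (x' n) * rnorm (y' n))).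
    exact: cvg_series_interleave.
  by apply/funext => n; rewrite /interleave; case: ifP.
move=> z.
rewrite (_ : (fun n => _) = interleave (fun n => rank_one (x n) (y n) z)
  (fun n => rank_one (x' n) (y' n) z)).
  by apply: cvg_series_interleave; [exact: xya|exact: xya'].
by apply/funext => n; rewrite /interleave; case: ifP.
Qed.

Lemma is_trace_class_submod_closed : submod_closed is_trace_class.
Proof.
split; first by apply/asboolP; do 3 eexists; exact: represents0.
move=> c a b /asboolP[x [y [s xya]]] /asboolP[x' [y' [s' xya']]].
apply/asboolP; do 3 eexists.
by apply: representsD; [apply: representsZ; exact: xya|exact: xya'].
Qed.

HB.instance Definition _ := GRing.isSubmodClosed.Build R[i] (H -> H)
  is_trace_class is_trace_class_submod_closed.

(* S_1(H), identified with the projective tensor product of H and its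
   conjugate: the norm of a is the infimum of sum_n |x_n| |y_n| over all the
   representations of a as a sum of elementary tensors x_n (x) y_n. *)
Record trace_class := TraceClass {
  tc_val :> H -> H; tc_valP : tc_val \in is_trace_class }.

HB.instance Definition _ := [isSub for tc_val].
HB.instance Definition _ := [Choice of trace_class by <:].
HB.instance Definition _ := [SubChoice_isSubLmodule of trace_class by <:].

Definition trace_rnorm (a : trace_class) : R :=
  inf [set s | exists x y, represents x y a s].

Lemma represents_ge0 x y a s : represents x y a s -> 0 <= s.
Proof.
move=> [xys _]; apply: (ler_cvg_to (cvg_cst (0 : R)) xys).
apply: nearW => n; rewrite seriesEnat/=; apply: sumr_ge0 => i _.
by rewrite mulr_ge0 ?rnorm_ge0.
Qed.

Lemma represents_bound x y a s z : represents x y a s ->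
  rnorm (a z) <= 2 * rnorm z * s.
Proof.
move=> [xys xya].
have h n : rnorm (series (fun n => rank_one (x n) (y n) z) n) <=
    2 * rnorm z * series (fun n => rnorm (x n) * rnorm (y n)) n.
  elim: n => [|n IHn].
    by rewrite !seriesEnat/= !big_geq// rnorm0 mulr0.
  rewrite !seriesSr mulrDr (le_trans (rnormD _ _))// lerD// /rank_one rnormZ.
  rewrite (mulrC (rnorm (x n))) mulrA ler_wpM2r ?rnorm_ge0//.
  by rewrite -mulrA inner_bound.
have cn : (fun n => rnorm (series (fun n => rank_one (x n) (y n) z) n)) @ \oo
    --> rnorm (a z).
  exact: cvg_rnorm (xya z).
apply: (ler_cvg_to cn (cvgM (cvg_cst (2 * rnorm z)) xys)).
exact: nearW.
Qed.

Lemma trace_has_inf (a : trace_class) : 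
  has_inf [set s | exists x y, represents x y a s].
Proof.
split.
  by have /asboolP[x [y [s xya]]] := tc_valP a; exists s, x, y.
by exists 0 => s [x [y /represents_ge0]].
Qed.

Lemma trace_rnorm_ge0 a : 0 <= trace_rnorm a.
Proof.
apply: lb_le_inf; first by have [] := trace_has_inf a.
by move=> s [x [y /represents_ge0]].
Qed.

Lemma trace_rnorm_le (a : trace_class) x y s :
  represents x y a s -> trace_rnorm a <= s.
Proof.
by move=> xya; apply: ge_inf; [have [] := trace_has_inf a|exists x, y].
Qed.

Lemma trace_rnorm_lt (a : trace_class) e : 0 < e ->
  exists x y s, represents x y a s /\ s < trace_rnorm a + e.
Proof.
move=> e0; have [s [x [y xya]] se] := inf_adherent e0 (trace_has_inf a).
by exists x, y, s.
Qed.

Lemma trace_rnormD a b :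
  trace_rnorm (a + b) <= trace_rnorm a + trace_rnorm b.
Proof.
apply/ler_addgt0Pr => e e0.
have e20 : 0 < e / 2 by rewrite divr_gt0.
have [x [y [s [xya sa]]]] := trace_rnorm_lt a e20.
have [x' [y' [s' [xyb sb]]]] := trace_rnorm_lt b e20.
apply: le_trans (trace_rnorm_le (a := a + b) (representsD xya xyb)) _.
by rewrite [e]splitr addrACA lerD// ltW.
Qed.

Let trace_rnormZ_le c a :
  trace_rnorm (c *: a) <= Normc.normc c * trace_rnorm a.
Proof.
have [->|c0] := eqVneq c 0.
  rewrite scale0r Normc.normc0 mul0r.
  exact: (trace_rnorm_le (a := 0) represents0).
have nc0 : 0 < Normc.normc c.
  rewrite lt_def normc_ge0 andbT.
  by apply: contra c0 => /eqP /Normc.eq0_normc ->.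
rewrite -ler_pdivrMl//; apply: lb_le_inf; first by have [] := trace_has_inf a.
move=> s [x [y xya]]; rewrite ler_pdivrMl//.
exact: (trace_rnorm_le (a := c *: a) (representsZ c xya)).
Qed.

Lemma trace_rnormZ c a :
  trace_rnorm (c *: a) = Normc.normc c * trace_rnorm a.
Proof.
apply/eqP; rewrite eq_le trace_rnormZ_le/=.
have [->|c0] := eqVneq c 0.
  by rewrite Normc.normc0 mul0r trace_rnorm_ge0.
have nc0 : 0 < Normc.normc c.
  rewrite lt_def normc_ge0 andbT.
  by apply: contra c0 => /eqP /Normc.eq0_normc ->.
have := trace_rnormZ_le c^-1 (c *: a).
by rewrite scalerA mulVf// scale1r Normc.normcV ler_pdivlMl.
Qed.

Lemma trace_rnorm_eq0 a : trace_rnorm a = 0 -> a = 0.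
Proof.
move=> a0; apply/val_inj/funext => z /=; apply: rnorm_eq0.
apply/eqP; rewrite eq_le rnorm_ge0 andbT.
apply/ler_addgt0Pr => e e0; rewrite add0r.
have z0 : 0 < 2 * rnorm z + 1 by rewrite ltr_wpDl// mulr_ge0 ?rnorm_ge0.
have [x [y [s [xya]]]] := trace_rnorm_lt a (divr_gt0 e0 z0).
rewrite a0 add0r ltr_pdivlMr// => se.
apply: le_trans (represents_bound z xya) _; apply: le_trans (ltW se).
by rewrite mulrC ler_wpM2l ?(represents_ge0 xya)// lerDl.
Qed.

Let norm_ (a : trace_class) : R[i] := (trace_rnorm a)%:C.

Let norm_D x y : norm_ (x + y) <= norm_ x + norm_ y.
Proof. by rewrite -rmorphD lecR trace_rnormD. Qed.

Let norm_Z c x : norm_ (c *: x) = `|c| * norm_ x.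
Proof. by rewrite /norm_ trace_rnormZ rmorphM. Qed.

Let norm_eq0 x : norm_ x = 0 -> x = 0.
Proof. by move=> /complexI; exact: trace_rnorm_eq0. Qed.

HB.instance Definition _ :=
  Lmodule_isNormed.Build R[i] trace_class norm_D norm_Z norm_eq0.

Lemma rank_one_trace_class (x y : H) : rank_one x y \in is_trace_class.
Proof.
apply/asboolP.
exists (fun n => if n is 0%N then x else 0),
  (fun n => if n is 0%N then y else 0).
exists (rnorm x * rnorm y); split.
  rewrite -(cvg_shiftS _)/= (_ : (fun n => _) = cst (rnorm x * rnorm y)).
    exact: cvg_cst.
  apply/funext => n; rewrite seriesEnat/= big_nat_recl//= big1 ?addr0//.
  by move=> i _; rewrite rnorm0 mul0r.
move=> z; rewrite -(cvg_shiftS _)/= (_ : (fun n => _) = cst (rank_one x y z)).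
  exact: cvg_cst.
apply/funext => n; rewrite seriesEnat/= big_nat_recl//= big1 ?addr0//.
by move=> i _; rewrite /rank_one scaler0.
Qed.

Definition tensor (x y : H) : trace_class :=
  TraceClass (rank_one_trace_class x y).

End trace_class.

Section bochner.
Context d (T : measurableType d) (R : realType).
Variable mu : {measure set T -> \bar R}.
Variable V : normedModType R[i].
Implicit Types f g s : T -> V.

Definition is_simple s : Prop :=
  finite_set (range s) /\
  forall v, v != 0 ->
    measurable (s @^-1` [set v]) /\ (mu (s @^-1` [set v]) < +oo)%E.

(* The value v = 0 contributes 0, whatever the measure of its fibre. *)
Definition simple_integral s : V :=
  \sum_(v \in range s) (fine (mu (s @^-1` [set v])))%:C *: v.

(* f is Bochner integrable, with integral x. The function g is a version of f
   for which the (Borel, hence not complete) measurability conditions hold. *)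
Definition is_bochner_integral f (x : V) : Prop :=
  exists (g : T -> V) (s : nat -> T -> V),
    [/\ f = g %[ae mu],
        forall n, is_simple (s n),
        forall n, measurable_fun setT (fun t => rnorm (g t - s n t)),
        (\int[mu]_t (rnorm (g t - s n t))%:E)%E @[n --> \oo] --> 0%E &
        simple_integral (s n) @[n --> \oo] --> x].

End bochner.

Section haar.
Context (R : realType).

(* The measure dt/|t|, carried by the Borel subsets of the real line. The
   point 0 is a null set, so that L2 haar is L^2 of the multiplicative group
   of non-zero reals. *)
Definition haar (A : set R) : \bar R :=
  (\int[lebesgue_measure]_(t in A) (`|t|^-1)%:E)%E.

Let m : measurable_fun setT (fun t : R => (`|t|^-1)%:E).
Proof.
apply/measurable_EFinP.
rewrite (_ : (fun t => _) = (fun t => `|t| `^ (-1))).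
  by apply: (measurableT_comp (measurable_powR _)).
by apply/funext => t; rewrite powR_inv1.
Qed.

Let haar0 : haar set0 = 0%E.
Proof. exact: integral_set0. Qed.

Let haar_ge0 A : (0 <= haar A)%E.
Proof. by apply: integral_ge0 => t _; rewrite lee_fin. Qed.

Let haar_semi_sigma_additive : semi_sigma_additive haar.
Proof.
apply: (@semi_sigma_additive_nng_induced _ _ R lebesgue_measure _ m) => t.
by rewrite lee_fin.
Qed.

HB.instance Definition _ := isMeasure.Build _ _ _
  haar haar0 haar_ge0 haar_semi_sigma_additive.

End haar.

Section operators.
Context (R : realType).
Local Notation H := (L2 (@haar R)).
Local Notation L2of := (@L2_of _ _ R (@haar R)).
Implicit Types x y : H.

Definition sgn_op x : H := L2of (fun t => (t / `|t|)%:C * x t).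
Definition flip_op x : H := L2of (fun t => x (- t)).
Definition conj_op x : H := L2of (fun t => conjc (x t)).
(* The point r = 0, which is junk, is only reached on a null set below. *)
Definition transl (r : R) x : H := L2of (fun t => x (r^-1 * t)).

(* The pointwise product of two elements of H is sent to 0 when it is not
   square-integrable. *)
Definition pmul x y : H := L2of (fun t => x t * y t).

Definition dconv_integrand (x y x' y' : H) (h : R) : trace_class (@haar R) :=
  tensor (pmul (transl (1 + h) x) (transl (1 + h^-1) x'))
         (pmul (transl (1 + h) y) (transl (1 + h^-1) y')).

Definition is_dual_convolution
    (m : trace_class (@haar R) -> trace_class (@haar R) ->
      trace_class (@haar R)) : Prop :=
  [/\ forall a, linear (m a),
      forall b, linear (m^~ b),
      forall a b, `|m a b| <= `|a| * `|b| &
      forall x y x' y', is_bochner_integral (@haar R)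
        (dconv_integrand x y x' y')
        (m (tensor x y) (tensor x' y'))].

(* The conditions above have exactly one solution; this is not proved here, and
   the default value 0 of xget is only a formality. *)
Definition dual_convolution :=
  xget (fun _ _ => 0) [set m | is_dual_convolution m].

End operators.

(* A normed space with a product; no axioms are imposed on the product. *)
Record normed_algebra (R : realType) := NormedAlgebra {
  algebra_space :> normedModType R[i];
  algebra_mul : algebra_space -> algebra_space -> algebra_space }.

Definition dconv_algebra (R : realType) : normed_algebra R :=
  NormedAlgebra (@dual_convolution R).

Definition cyclic (R : realType) (A : normed_algebra R) (D : A -> dual A) :
    Prop :=
  forall a b, D a b = - D b a.

(* Main.v *)
Require Import Defs.
From HB Require Import structures.
From mathcomp Require Import all_boot all_order all_algebra.
From mathcomp Require Import complex.
From mathcomp Require Import all_classical all_reals all_analysis.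
From mathcomp Require Import measurable_realfun ring lra.
Import Order.TTheory GRing.Theory Num.Theory.
Import numFieldNormedType.Exports.

Set Implicit Arguments.
Unset Strict Implicit.
Unset Printing Implicit Defensive.

Local Open Scope classical_set_scope.
Local Open Scope ring_scope.
Local Open Scope complex_scope.

(** Both claims are about the bilinear form (a, b) |-> D a b, and both are
    first seen on elementary tensors, whose sums are dense in the trace norm
    ([cvg_partial_tensors]).

    Cyclicity: the substitution t |-> -t preserves dt/|t|, fixes the factor in
    eta and, sgn being odd, changes the sign of the factor in xi
    ([inner_flip_conj], [inner_sgn_flip_conj]).  Hence D a b = - D b a for
    elementary tensors, and then for all a and b by continuity.

    Weak compactness: let theta be the antilinear isometry of the trace class
    ([twist]) that sends x (x) y to conj R S x (x) R conj y.  It undoes the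
    reflections, conjugations and sign in the formula for D, so that
    D (x (x) y) (theta (x' (x) y')) = <x, x'> <y', y>.  Thus D a (theta c) is
    the Hilbert-Schmidt inner product of a and c; in particular it is positive
    ([hilbert_schmidt_ge0]), and D factors through the Hilbert space of
    Hilbert-Schmidt operators, whose unit ball is weakly compact.

    The last step is proved in a form that avoids the completion
    ([weakly_compact_positive]).  Let p be the seminorm of the form
    D a (theta c).  An approximate Riesz theorem ([approximate_riesz]) holds on
    the incomplete space.  Applied to p-bounded functionals L, it shows that
    each L is a limit in norm of D a with p a bounded; applied to phi o D, with
    phi in the bidual, it shows that phi is, uniformly on a p-ball of
    functionals, close to the evaluation at a point.  On such a ball the weak
    topology is therefore the topology of pointwise convergence, for which the
    ball is compact. *)

(** * Limits in the complex plane *)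

Section complex_limits.
Context (R : realType).
Implicit Types (z w : R[i]).

Lemma rnorm_normc z : rnorm z = Normc.normc z.
Proof. by []. Qed.

Lemma normc_real (a : R) : Normc.normc a%:C = `|a|.
Proof. by rewrite /= expr0n/= addr0 sqrtr_sqr. Qed.

Lemma Re_add z w : complex.Re (z + w) = complex.Re z + complex.Re w.
Proof. by case: z w => [? ?] [? ?]. Qed.

Lemma Im_add z w : complex.Im (z + w) = complex.Im z + complex.Im w.
Proof. by case: z w => [? ?] [? ?]. Qed.

Lemma Re_sub z w : complex.Re (z - w) = complex.Re z - complex.Re w.
Proof. by case: z w => [? ?] [? ?]. Qed.

Lemma Im_sub z w : complex.Im (z - w) = complex.Im z - complex.Im w.
Proof. by case: z w => [? ?] [? ?]. Qed.

Lemma conjcD z w : conjc (z + w) = conjc z + conjc w.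
Proof. exact: rmorphD. Qed.

Lemma conjcM z w : conjc (z * w) = conjc z * conjc w.
Proof. exact: rmorphM. Qed.

(** The norm takes its values in R[i], which is only partially ordered; all
    estimates are made on its real part. *)
Lemma cvg_rnormP (V : normedModType R[i]) (I : Type) (F : set_system I)
    {FF : Filter F} (u : I -> V) (l : V) :
  u @ F --> l <-> forall e : R, 0 < e -> \forall i \near F, rnorm (l - u i) < e.
Proof.
split=> [/cvgrPdist_lt h e e0|h].
  have e0' : 0 < e%:C by rewrite ltcR.
  by apply: filterS (h _ e0') => i; rewrite rnormE ltcR.
apply/cvgrPdist_lt => -[a b]; rewrite ltcE/= => /andP[/eqP b0 a0].
by apply: filterS (h _ a0) => i; rewrite rnormE b0 ltcR.
Qed.

Lemma cvg_Re (I : Type) (F : set_system I) {FF : Filter F} (u : I -> R[i]) z :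
  u @ F --> z -> (fun i => complex.Re (u i)) @ F --> complex.Re z.
Proof.
move=> /cvg_rnormP uz; apply/cvgrPdist_lt => e e0.
apply: filterS (uz _ e0) => i; apply: le_lt_trans.
by rewrite -Re_sub rnorm_normc Re_le_normc.
Qed.

Lemma cvg_Im (I : Type) (F : set_system I) {FF : Filter F} (u : I -> R[i]) z :
  u @ F --> z -> (fun i => complex.Im (u i)) @ F --> complex.Im z.
Proof.
move=> /cvg_rnormP uz; apply/cvgrPdist_lt => e e0.
apply: filterS (uz _ e0) => i; apply: le_lt_trans.
by rewrite -Im_sub rnorm_normc Im_le_normc.
Qed.

Lemma cvg_complex (I : Type) (F : set_system I) {FF : Filter F} (u : I -> R[i])
    (a b : R) :
  (fun i => complex.Re (u i)) @ F --> a ->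
  (fun i => complex.Im (u i)) @ F --> b -> u @ F --> (a +i* b).
Proof.
move=> /cvgrPdist_lt ua /cvgrPdist_lt ub; apply/cvg_rnormP => e e0.
have e20 : 0 < e / 2 by rewrite divr_gt0.
apply: filterS2 (ua _ e20) (ub _ e20) => i h1 h2; rewrite rnorm_normc.
move: h1 h2; case: (u i) => x y /= h1 h2.
by apply: le_lt_trans (normc_le _ _) _; rewrite [ltRHS]splitr ltrD.
Qed.

Lemma cvg_ge0 (u : nat -> R[i]) z :
  (forall n, 0 <= u n) -> u @ \oo --> z -> 0 <= z.
Proof.
move=> u0 uz.
have u0' i : 0 <= complex.Re (u i) /\ complex.Im (u i) = 0.
  by have := u0 i; case: (u i) => a b; rewrite lecE/= => /andP[/eqP-> ->].
have Rz : 0 <= complex.Re z.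
  apply: (ler_cvg_to (cvg_cst (0 : R)) (cvg_Re uz)).
  by apply: nearW => i; case: (u0' i).
have Iz : complex.Im z = 0.
  apply: (@cvg_unique _ _ ((fun i => complex.Im (u i)) @ \oo)) => //.
    exact: (cvg_Im uz).
  rewrite (_ : (fun i => _) = (fun _ => 0)); first exact: cvg_cst.
  by apply/funext => i; case: (u0' i).
by case: z Rz Iz {uz} => a b /= a0 ->; rewrite lecE/= eqxx.
Qed.

Lemma cvg_affine (I : Type) (F : set_system I) {FF : Filter F}
    (u v : I -> R[i]) (k a b : R[i]) : u @ F --> a -> v @ F --> b ->
  (fun i => k * u i + v i) @ F --> k * a + b.
Proof.
move=> /cvg_rnormP ua /cvg_rnormP vb; apply/cvg_rnormP => e e0.
have e20 : 0 < e / 2 by rewrite divr_gt0.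
have k1 : 0 < Normc.normc k + 1 by rewrite ltr_wpDl// normc_ge0.
apply: filterS2 (ua _ (divr_gt0 e20 k1)) (vb _ e20) => i h1 h2.
have -> : k * a + b - (k * u i + v i) = k * (a - u i) + (b - v i) by ring.
apply: le_lt_trans (rnormD _ _) _; rewrite [ltRHS]splitr ler_ltD//.
rewrite rnorm_normc Normc.normcM -(rnorm_normc (a - u i)).
apply: (@le_trans _ _ ((Normc.normc k + 1) * rnorm (a - u i))).
  by rewrite ler_wpM2r ?rnorm_ge0// lerDl.
by rewrite mulrC -ler_pdivlMr// ltW.
Qed.

Lemma ultra_fmap (X Y : Type) (F : set_system X) (g : X -> Y) :
  UltraFilter F -> UltraFilter (g @ F).
Proof.
move=> FU; split; first exact: fmap_proper_filter.
move=> G GG FG; apply/predeqP => A; split=> [GA|]; last exact: FG.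
have [//|FnA] := in_ultra_setVsetC (g @^-1` A) FU.
have GnA : G (~` A) by exact: FG.
by have [y []] := filter_ex (filterI GA GnA).
Qed.

Lemma ultra_bounded_cvg_real (X : Type) (F : set_system X) (g : X -> R)
    (r : R) :
  UltraFilter F -> F [set x | `|g x| <= r] -> exists l : R, g @ F --> l.
Proof.
move=> FU Fr; have := @segment_compact R (- r) r.
rewrite compact_ultra => /(_ (g @ F) (ultra_fmap g FU)) h.
have [|l [_ gl]] := h; last by exists l.
suff : F (g @^-1` [set` `[- r, r]]) by [].
by apply: filterS Fr => x /=; rewrite ler_norml in_itv.
Qed.

(** This is the compactness of closed discs. *)
Lemma ultra_bounded_cvg (X : Type) (F : set_system X) (g : X -> R[i]) (r : R) :
  UltraFilter F -> F [set x | rnorm (g x) <= r] -> exists l : R[i], g @ F --> l.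
Proof.
move=> FU Fr.
have [|a ga] := @ultra_bounded_cvg_real _ F (fun x => complex.Re (g x)) r FU.
  by apply: filterS Fr => x /=; apply: le_trans; exact: Re_le_normc.
have [|b gb] := @ultra_bounded_cvg_real _ F (fun x => complex.Im (g x)) r FU.
  by apply: filterS Fr => x /=; apply: le_trans; exact: Im_le_normc.
by exists (a +i* b); exact: cvg_complex.
Qed.

End complex_limits.

(** * Bounded functionals *)

Section dual_facts.
Context (R : realType) (V : normedModType R[i]).

Lemma dualD (phi : dual V) x y : phi (x + y) = phi x + phi y.
Proof. by have := dual_scalar phi 1 x y; rewrite scale1r mul1r. Qed.

Lemma dualB (phi : dual V) x y : phi (x - y) = phi x - phi y.
Proof. by rewrite dualD -scaleN1r dualZ mulN1r. Qed.

Lemma dual_sum (phi : dual V) (F : nat -> V) n :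
  phi (\sum_(0 <= i < n) F i) = \sum_(0 <= i < n) phi (F i).
Proof.
by apply: (big_morph (phi : V -> R[i])) => [x y|]; [exact: dualD|exact: dual0].
Qed.

Lemma dual_le (phi : dual V) x : rnorm (phi x) <= rnorm phi * rnorm x.
Proof.
have [->|x0] := eqVneq x 0; first by rewrite dual0 !rnorm0 mulr0.
have nx0 : 0 < rnorm x.
  rewrite lt_def rnorm_ge0 andbT; apply: contra x0 => /eqP/rnorm_eq0 ->.
  exact: eqxx.
have := @dual_rnorm_ub _ _ phi ((rnorm x)^-1%:C *: x).
rewrite dualZ (rnorm_normc (_ * _)) Normc.normcM -rnorm_normc rnormE rnormZ.
rewrite (rnorm_normc _%:C) !normc_real ger0_norm ?invr_ge0 ?rnorm_ge0//.
rewrite mulVf ?gt_eqF// => /(_ (lexx _)).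
by rewrite mulrC ler_pdivrMr.
Qed.

Lemma dual_norm_le (phi : dual V) (M : R) : 0 <= M ->
  (forall x, rnorm (phi x) <= M * rnorm x) -> rnorm phi <= M.
Proof.
move=> M0 h; apply: dual_rnorm_le => x; rewrite rnormE -[1]/(1%:C) lecR => x1.
by apply: le_trans (h x) _; rewrite ler_piMr.
Qed.

Lemma rnorm_le1 (x : V) : (`|x| <= 1) = (rnorm x <= 1).
Proof. by rewrite rnormE -[1]/(1%:C) lecR. Qed.

Lemma linear_bound (W : normedModType R[i]) (f : {linear V -> W}) :
  continuous f -> exists2 M : R, 0 <= M & forall x, rnorm (f x) <= M * rnorm x.
Proof.
move=> cf; have /linear_boundedP : bounded_near f (nbhs (0 : V)).
  by apply: continuous_linear_bounded; exact: cf.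
move=> [M [Mreal Mf]].
exists (`|complex.Re M| + 1); first by rewrite addr_ge0.
move=> x; rewrite -lecR rmorphM/= -!rnormE; apply: Mf.
have -> : M = (complex.Re M)%:C by rewrite RRe_real.
by rewrite ltcR/= (le_lt_trans (ler_norm _))// ltrDl.
Qed.

Lemma mk_dual_subproof (f : V -> R[i]) (M : R) : scalar f ->
  (forall x, rnorm (f x) <= M * rnorm x) -> f \in @bounded_functional R V.
Proof.
move=> lf fM; apply/asboolP; split => //.
pose g : {linear V -> R[i]} :=
  HB.pack f (GRing.isLinear.Build _ _ _ _ _ lf).
have : continuous g.
  apply: bounded_linear_continuous; apply/linear_boundedP.
  exists M%:C; split; first by rewrite complex_real eqxx.
  move=> N MN x; rewrite !rnormE.
  apply: (@le_trans _ _ (M * rnorm x)%:C); first by rewrite lecR.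
  rewrite rmorphM/=; apply: ler_wpM2r; last exact: ltW.
  by rewrite -rnormE normr_ge0.
by [].
Qed.

Definition mk_dual (f : V -> R[i]) (M : R) (lf : scalar f)
  (fM : forall x, rnorm (f x) <= M * rnorm x) : dual V :=
  Dual (mk_dual_subproof lf fM).

Lemma rnormN (x : V) : rnorm (- x) = rnorm x.
Proof. by rewrite /rnorm normrN. Qed.

End dual_facts.

Lemma cvg_dual_pair (R : realType) (V : normedModType R[i])
    (u : nat -> dual V) (b : nat -> V) (phi : dual V) (c : V) :
  u @ \oo --> phi -> b @ \oo --> c ->
  (fun n => u n (b n) : R[i]) @ \oo --> phi c.
Proof.
move=> uphi bc.
have uphi0 : (fun n => rnorm (phi - u n)) @ \oo --> (0 : R).
  rewrite -(rnorm0 (dual V)) -(subrr phi).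
  by apply: cvg_rnorm; apply: cvgB => //; exact: cvg_cst.
have bc0 : (fun n => rnorm (c - b n)) @ \oo --> (0 : R).
  rewrite -(rnorm0 V) -(subrr c).
  by apply: cvg_rnorm; apply: cvgB => //; exact: cvg_cst.
have bn : (fun n => rnorm (b n)) @ \oo --> rnorm c by exact: cvg_rnorm bc.
have maj : (fun n => rnorm phi * rnorm (c - b n) +
    rnorm (phi - u n) * rnorm (b n)) @ \oo --> (0 : R).
  rewrite -[X in _ --> X]addr0 -[X in _ --> X + _](mulr0 (rnorm phi)).
  rewrite -[X in _ --> _ + X](mul0r (rnorm c)).
  by apply: cvgD; apply: cvgM => //; exact: cvg_cst.
apply/cvg_rnormP => e e0; move/cvgrPdist_lt/(_ _ e0) : maj.
apply: filterS => n; rewrite sub0r normrN => /(le_lt_trans (ler_norm _)).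
apply: le_lt_trans.
rewrite (_ : phi c - u n (b n) = phi (c - b n) + (phi - u n) (b n)).
  by apply: le_trans (rnormD _ _) _; rewrite lerD// dual_le.
by rewrite dualB -[(phi - u n) _]/(phi (b n) - u n (b n)); ring.
Qed.

(** * Positive sesquilinear forms *)

Section positive_form.
Context (R : realType) (V : lmodType R[i]) (h : V -> V -> R[i]).
Hypothesis hDl : forall a b c, h (a + b) c = h a c + h b c.
Hypothesis hZl : forall k a c, h (k *: a) c = k * h a c.
Hypothesis hDr : forall a c d, h a (c + d) = h a c + h a d.
Hypothesis hZr : forall k a c, h a (k *: c) = conjc k * h a c.
Hypothesis h_ge0 : forall a, 0 <= h a a.

Definition sqf (a : V) : R := complex.Re (h a a).
Definition seminorm (a : V) : R := Num.sqrt (sqf a).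

Lemma sqfE a : h a a = (sqf a)%:C.
Proof.
rewrite /sqf; have := h_ge0 a; case: (h a a) => x y.
by rewrite lecE/= => /andP[/eqP-> _].
Qed.

Lemma sqf_ge0 a : 0 <= sqf a.
Proof. by rewrite -lecR -sqfE. Qed.

Lemma seminorm_ge0 a : 0 <= seminorm a.
Proof. exact: sqrtr_ge0. Qed.

Lemma sqr_seminorm a : seminorm a ^+ 2 = sqf a.
Proof. by rewrite sqr_sqrtr// sqf_ge0. Qed.

(** A positive form is Hermitian, by polarization: its values at a + b and at
    a + i b are real. *)
Lemma form_conj a b : h b a = conjc (h a b).
Proof.
have e1 : complex.Im (h a b) + complex.Im (h b a) = 0.
  have := congr1 (@complex.Im R) (sqfE (a + b)).
  rewrite !hDl !hDr !sqfE; move: (h a b) (h b a) => [x y] [z w] /= <-; ring.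
have e2 : complex.Re (h b a) - complex.Re (h a b) = 0.
  have := congr1 (@complex.Im R) (sqfE (a + 'i *: b)).
  rewrite !hDl !hDr !hZl !hZr !sqfE.
  move: (h a b) (h b a) => [x y] [z w] /= <-; ring.
move: e1 e2; case: (h a b) (h b a) => [x y] [z w] /= e1 e2.
by congr (_ +i* _); lra.
Qed.

Lemma sqfDZ a b k : sqf (a + k *: b) =
  sqf a + 2 * complex.Re (k * h b a) + Normc.normc k ^+ 2 * sqf b.
Proof.
rewrite {1}/sqf !hDl !hDr !hZl !hZr (form_conj b a) !sqfE.
case: k => s t; case: (h b a) => x y /=; rewrite sqr_sqrtr; last first.
  by rewrite addr_ge0 ?sqr_ge0.
ring.
Qed.

(** This serves twice: with E = sqf a it gives the Cauchy-Schwarz inequality,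
    and with E = e ^ 2 it turns the near-minimality of a vector into a bound on
    the error in the Riesz representation. *)
Lemma quadratic_discriminant (d Q E : R) : 0 <= d -> 0 <= Q -> 0 <= E ->
  (forall s, 0 <= s -> 2 * (s * d) <= s ^+ 2 * Q + E) -> d ^+ 2 <= Q * E.
Proof.
move=> d0 Q0 E0 H; have [->|dn0] := eqVneq d 0.
  by rewrite expr0n/= mulr_ge0.
have dp : 0 < d by rewrite lt_def dn0.
have [Qe|Qn0] := eqVneq Q 0.
  have := H ((E + 1) / d); rewrite Qe divfK// mulr0 add0r.
  by move=> /(_ ltac:(by rewrite divr_ge0// addr_ge0)); lra.
have Qp : 0 < Q by rewrite lt_def Qn0.
have := H (d / Q) (divr_ge0 d0 Q0).
have -> : (d / Q) ^+ 2 * Q = d ^+ 2 / Q by field.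
have -> : d / Q * d = d ^+ 2 / Q by ring.
by move=> ?; rewrite -ler_pdivrMl// mulrC; lra.
Qed.

Lemma complex_phase (z : R[i]) :
  exists2 u : R[i], Normc.normc u = 1 & u * z = (Normc.normc z)%:C.
Proof.
have [->|z0] := eqVneq z 0.
  by exists 1; rewrite ?mulr0 ?Normc.normc0// Normc.normc1.
exists (`|z| / z); last by rewrite divfK.
have nz : `|z| != 0 by rewrite normr_eq0.
have : `| `|z| / z| = 1 by rewrite normrM normfV normr_id divff.
by move=> /(congr1 (@complex.Re R)).
Qed.

Lemma cauchy_schwarz a b : Normc.normc (h a b) <= seminorm a * seminorm b.
Proof.
have [u u1 uh] := complex_phase (h b a).
rewrite form_conj normc_conjc -ler_sqr ?nnegrE ?normc_ge0//; last first.
  by rewrite mulr_ge0 ?seminorm_ge0.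
rewrite exprMn !sqr_seminorm mulrC.
apply: quadratic_discriminant; rewrite ?sqf_ge0 ?normc_ge0// => s s0.
have := sqf_ge0 (a + (- s%:C * u) *: b).
rewrite sqfDZ Normc.normcM u1 mulr1 -mulrA uh normcN normc_real ger0_norm//.
by rewrite -rmorphN -rmorphM/=; lra.
Qed.

(** An exact minimiser c of J = |c|^2 - 2 Re (f c) would represent f.  Since
    J >= - M ^ 2, some c comes within e ^ 2 of the infimum; moving it in the
    direction of b then lowers J by at most e ^ 2, which bounds f b - h b c.
    The bound on c follows from J c <= J 0 + e ^ 2. *)
Lemma approximate_riesz (f : V -> R[i]) (M e : R) : scalar f -> 0 <= M ->
  0 < e -> (forall a, Normc.normc (f a) <= M * seminorm a) ->
  exists c, seminorm c <= 2 * M + e /\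
    forall a, Normc.normc (f a - h a c) <= e * seminorm a.
Proof.
move=> lf M0 e0 fM.
pose J c := sqf c - 2 * complex.Re (f c).
have J_ge c : - M ^+ 2 <= J c.
  have : complex.Re (f c) <= M * seminorm c.
    by apply: le_trans (fM c); exact: le_trans (ler_norm _) (Re_le_normc _).
  have := sqr_ge0 (seminorm c - M).
  by rewrite sqrrB sqr_seminorm /J => ? ?; lra.
have J0 : J 0 = 0.
  have f00 : f 0 = 0.
    by have := lf 1 0 0; rewrite scale1r mul1r addr0 => /eqP;
      rewrite -subr_eq subrr eq_sym => /eqP.
  have := hZl 0 0 0; rewrite scale0r mul0r => h00.
  by rewrite /J /sqf f00 h00/= mulr0 subr0.
have infJ : has_inf (range J).
  by split; [exists (J 0), 0|exists (- M ^+ 2) => _ [c _ <-]].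
have [_ [c _ <-] Jc] := inf_adherent (exprn_gt0 2 e0) infJ.
have Jmin b : J c <= J b + e ^+ 2.
  apply: le_trans (ltW Jc) _; rewrite lerD2r.
  by apply: ge_inf; [case: infJ|exists b].
exists c; split.
  have := Jmin 0; rewrite J0 add0r.
  have : complex.Re (f c) <= M * seminorm c.
    by apply: le_trans (fM c); exact: le_trans (ler_norm _) (Re_le_normc _).
  rewrite /J -sqr_seminorm => ? ?; rewrite -lerBlDl.
  have : (seminorm c - M) ^+ 2 <= (M + e) ^+ 2.
    by rewrite sqrrB sqrrD; have := mulr_ge0 M0 (ltW e0); lra.
  have Me0 : 0 <= M + e by rewrite addr_ge0// ltW.
  rewrite -real_normK ?num_real// ler_sqr ?nnegrE// => /(le_trans (ler_norm _)).
  lra.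
move=> b; have [u u1 uz] := complex_phase (f b - h b c).
rewrite -ler_sqr ?nnegrE ?normc_ge0//; last first.
  by rewrite mulr_ge0 ?seminorm_ge0// ltW.
rewrite exprMn sqr_seminorm mulrC.
apply: quadratic_discriminant; rewrite ?sqf_ge0 ?normc_ge0 ?sqr_ge0// => s s0.
have := Jmin (c + (s%:C * u) *: b).
rewrite /J sqfDZ Normc.normcM u1 mulr1 normc_real ger0_norm//.
rewrite [c + _]addrC lf Re_add -!(mulrA s%:C).
have : complex.Re (s%:C * (u * (f b - h b c))) = s * Normc.normc (f b - h b c).
  by rewrite uz -rmorphM.
rewrite mulrBr mulrBr Re_sub => ?; lra.
Qed.
End positive_form.

(** * The weak topology *)

Section weak_topology.
Context (R : realType) (W : normedModType R[i]).

Lemma weak_continuous (phi : dual W) :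
  continuous ((phi : W -> R[i]) : weak W -> R[i]).
Proof.
move=> x; pose ev (y : weak W) : prod_topology (fun _ : dual W => R[i]) :=
  fun psi => psi y.
have cev : continuous ev by exact: initial_continuous.
have := @proj_continuous _ (fun _ : dual W => R[i]) phi (ev x).
exact: (continuous_comp (cev x)).
Qed.

Lemma cvg_weak (F : set_system W) (x : W) : Filter F ->
  (forall phi : dual W, phi @ F --> phi x) -> F --> (x : weak W).
Proof.
move=> FF h; pose ev (y : weak W) : {ptws dual W -> R[i]} :=
  fun psi => psi y.
have hev : ev @ F --> (ev x : {ptws dual W -> R[i]}).
  by apply/pointwise_cvgP => phi; exact: h.
move=> A [_ [[B oB <-] Bx] BA].
have FB : F (ev @^-1` B) by apply: hev; exact: open_nbhs_nbhs.
exact: filterS FB.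
Qed.

Lemma dual_ev_scalar (b : W) : scalar (fun phi : dual W => phi b).
Proof. by move=> k phi psi. Qed.

Lemma dual_ev_bound (b : W) (phi : dual W) :
  rnorm (phi b) <= rnorm b * rnorm phi.
Proof. by rewrite mulrC dual_le. Qed.

Definition dual_ev (b : W) : dual (dual W) :=
  mk_dual (@dual_ev_scalar b) (@dual_ev_bound b).

End weak_topology.

(** * A positivity criterion for weak compactness *)

Section weakly_compact_positive.
Context (R : realType) (V : normedModType R[i]).
Variables (D : {linear V -> dual V}) (theta : V -> V).
Hypothesis D_cont : continuous D.
Hypothesis thetaD : forall a b, theta (a + b) = theta a + theta b.
Hypothesis thetaZ : forall k a, theta (k *: a) = conjc k *: theta a.
Hypothesis theta_norm : forall a, rnorm (theta a) = rnorm a.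
Hypothesis theta_surj : forall b, exists a, theta a = b.
Hypothesis D_theta_ge0 : forall a, 0 <= D a (theta a).

Let h a c : R[i] := D a (theta c).

Let hDl a b c : h (a + b) c = h a c + h b c.
Proof. by rewrite /h linearD. Qed.

Let hZl k a c : h (k *: a) c = k * h a c.
Proof. by rewrite /h linearZ. Qed.

Let hDr a c d : h a (c + d) = h a c + h a d.
Proof. by rewrite /h thetaD dualD. Qed.

Let hZr k a c : h a (k *: c) = conjc k * h a c.
Proof. by rewrite /h thetaZ dualZ. Qed.

Let h_ge0 a : 0 <= h a a. Proof. exact: D_theta_ge0. Qed.

Let p := seminorm h.

Let p_ge0 a : 0 <= p a. Proof. exact: seminorm_ge0. Qed.

Let p_bounded : exists2 C : R, 0 <= C & forall a, p a <= C * rnorm a.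
Proof.
have [N N0 DN] := linear_bound D_cont.
exists (Num.sqrt N); first exact: sqrtr_ge0.
move=> a; rewrite -ler_sqr ?nnegrE ?mulr_ge0 ?sqrtr_ge0 ?rnorm_ge0//.
rewrite [p a ^+ 2](sqr_seminorm h_ge0) exprMn sqr_sqrtr// /sqf.
apply: le_trans (ler_norm _) _; apply: le_trans (Re_le_normc _) _.
apply: le_trans (dual_le _ _) _.
by rewrite theta_norm expr2 mulrA ler_wpM2r ?rnorm_ge0.
Qed.

(** The ball of radius C in the dual of the Hilbert space completion of (V, p),
    embedded in dual V through theta. *)
Let K (C : R) : set (dual V) :=
  [set L | forall c, rnorm (L (theta c)) <= C * p c].

Let K_norm (C : R) (L : dual V) : 0 <= C -> (forall a, p a <= C * rnorm a) ->
  forall e : R, 0 <= e -> (forall c, rnorm (L (theta c)) <= e * p c) ->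
  rnorm L <= e * C.
Proof.
move=> C0 pC e e0 Le; apply: dual_norm_le; first exact: mulr_ge0.
move=> x; have [c <-] := theta_surj x.
by apply: le_trans (Le c) _; rewrite theta_norm -mulrA ler_wpM2l.
Qed.

(** K lies in the norm closure of the image of D: an approximate Riesz vector a
    of c |-> conj (L (theta c)) makes D a close to L. *)
Let K_approx (C : R) : 0 <= C -> (forall a, p a <= C * rnorm a) ->
  forall L, K C L -> forall d : R, 0 < d ->
  exists a, p a <= 2 * C + 1 /\ rnorm (L - D a) <= d.
Proof.
move=> C0 pC L KL d d0.
have C1 : 0 < C + 1 by rewrite ltr_wpDl.
(* The distance from L to D a will be at most e * C <= d. *)
pose e := Num.min 1 (d / (C + 1)).
have e0 : 0 < e by rewrite lt_min ltr01 divr_gt0.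
pose f c := conjc (L (theta c)).
have lf : scalar f.
  move=> k a b; rewrite /f thetaD thetaZ dual_scalar.
  by rewrite rmorphD rmorphM/= conjcK.
have [//|a [pa fa]] := approximate_riesz hDl hZl hDr hZr h_ge0 lf C0 e0.
  by move=> c; rewrite normc_conjc; exact: KL.
exists a; split.
  by apply: le_trans pa _; rewrite lerD2l ge_min lexx.
apply: (@le_trans _ _ (e * C)); last first.
  apply: (@le_trans _ _ (d / (C + 1) * C)).
    by rewrite ler_wpM2r// ge_min lexx orbT.
  by rewrite mulrAC ler_pdivrMr// ler_wpM2l ?ltW// ltrDl.
apply: K_norm => //; first exact: ltW.
move=> c; apply: le_trans (fa c).
rewrite -normc_conjc (form_conj hDl hZl hDr hZr h_ge0 a c).
by rewrite /f rmorphB/= !conjcK.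
Qed.

Let D_norm (C : R) : 0 <= C -> (forall a, p a <= C * rnorm a) ->
  forall a, rnorm (D a) <= p a * C.
Proof.
move=> C0 pC a; apply: K_norm => // c.
exact: (cauchy_schwarz hDl hZl hDr hZr h_ge0).
Qed.

(** On K, a functional phi of the bidual is a uniform limit of evaluations: as
    phi o D is bounded for p, it is close to D _ (theta c) for some c, and
    K_approx carries the estimate from the image of D over to K. *)
Let bidual_approx (C : R) : 0 <= C -> (forall a, p a <= C * rnorm a) ->
  forall (phi : dual (dual V)) (e : R), 0 < e ->
  exists b, forall L, K C L -> rnorm (phi L - L b) <= e.
Proof.
move=> C0 pC phi e e0.
have C1 : 0 < 2 * C + 1 by rewrite ltr_wpDl// mulr_ge0.
pose e' := e / 2 / (2 * C + 1).
have e'0 : 0 < e' by rewrite !divr_gt0.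
pose f a := phi (D a).
have lf : scalar f by move=> k a b; rewrite /f linearP dual_scalar.
have M0 : 0 <= rnorm phi * C by rewrite mulr_ge0// rnorm_ge0.
have [|c [_ fc]] := approximate_riesz hDl hZl hDr hZr h_ge0 lf M0 e'0.
  move=> a; apply: le_trans (dual_le _ _) _.
  by rewrite -mulrA ler_wpM2l ?rnorm_ge0// mulrC D_norm.
exists (theta c) => L KL.
have N0 : 0 < rnorm phi + rnorm (theta c) + 1.
  by rewrite ltr_wpDl// addr_ge0 ?rnorm_ge0.
(* With |L - D a| <= e / 2 / N, replacing L by D a under phi and under the
   evaluation at theta c costs at most e / 2 in all. *)
pose N := rnorm phi + rnorm (theta c) + 1.
have [|a [pa La]] := K_approx C0 pC KL (d := e / 2 / N).
  by rewrite !divr_gt0.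
have -> : phi L - L (theta c) = phi (L - D a) +
    (phi (D a) - h a c) - (L - D a) (theta c).
  by rewrite -[(L - D a) _]/(L (theta c) - D a (theta c)) dualB /h; ring.
apply: le_trans (rnormD _ _) _; rewrite rnormN.
apply: le_trans (lerD (rnormD _ _) (dual_le _ _)) _.
have h1 : rnorm (phi (L - D a)) <= rnorm phi * (e / 2 / N).
  by apply: le_trans (dual_le _ _) _; rewrite ler_wpM2l// rnorm_ge0.
have h2 : rnorm (phi (D a) - h a c) <= e / 2.
  apply: le_trans (fc a) _; rewrite /e' mulrAC ler_pdivrMr//.
  by rewrite ler_wpM2l// ltW// divr_gt0.
have h3 : rnorm (L - D a) * rnorm (theta c) <= e / 2 / N * rnorm (theta c).
  by rewrite ler_wpM2r// rnorm_ge0.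
have h4 : e / 2 / N * N = e / 2 by rewrite divfK// gt_eqF.
have h5 : 0 <= e / 2 / N by rewrite !divr_ge0// ltW.
by rewrite [in X in _ * X]/N !mulrDr mulr1 in h4; lra.
Qed.

Let K_closed C : closed (K C : set (weak (dual V))).
Proof.
move=> L clL c; apply/ler_addgt0Pr => e e0.
have /cvg_rnormP /(_ _ e0) near_L := @weak_continuous _ _ (dual_ev (theta c)) L.
have [L' [KL']] := clL _ near_L.
rewrite /= => LL'.
rewrite -[L (theta c)](subrK (L' (theta c))) addrC.
by apply: le_trans (rnormD _ _) _; rewrite lerD ?KL'// ltW.
Qed.

(** An ultrafilter on K converges at each point, since discs are compact, and
    its pointwise limit is again in K; by bidual_approx the convergence is
    weak. *)
Let K_compact (C : R) : 0 <= C -> (forall a, p a <= C * rnorm a) ->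
  compact (K C : set (weak (dual V))).
Proof.
move=> C0 pC; rewrite compact_ultra => F FU FK.
have /choice[L FL] : forall b, exists l : R[i],
    (fun phi : dual V => phi b) @ F --> l.
  move=> b; have [c <-] := theta_surj b.
  by apply: (ultra_bounded_cvg (r := C * p c)); apply: filterS FK => phi; apply.
have lL : scalar L.
  move=> k a b.
  apply: (@cvg_unique _ _ ((fun phi : dual V => phi (k *: a + b)) @ F)) => //.
    exact: (FL (k *: a + b)).
  rewrite (_ : (fun phi => _) = (fun phi : dual V => k * phi a + phi b)).
    exact: cvg_affine (FL a) (FL b).
  by apply/funext => phi; rewrite dual_scalar.
have LK c : rnorm (L (theta c)) <= C * p c.
  apply/ler_addgt0Pr => e e0.
  have /cvg_rnormP /(_ _ e0) near_L := FL (theta c).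
  have [phi [Lphi /(_ c) phic]] := filter_ex (filterI near_L FK).
  rewrite -[L (theta c)](subrK (phi (theta c))) addrC.
  by apply: le_trans (rnormD _ _) _; rewrite lerD// ltW.
have Lb b : rnorm (L b) <= C * C * rnorm b.
  have [c <-] := theta_surj b; apply: le_trans (LK c) _.
  by rewrite theta_norm -mulrA ler_wpM2l.
exists (mk_dual lL Lb); split; first exact: LK.
apply: cvg_weak => phi; apply/cvg_rnormP => e e0.
have e30 : 0 < e / 3 by rewrite divr_gt0.
have [b phib] := bidual_approx C0 pC phi e30.
have /cvg_rnormP /(_ _ e30) near_L := FL b.
apply: filterS2 near_L FK => L' L'b KL'.
have h1 := phib _ KL'; have h2 := phib (mk_dual lL Lb) LK.
have -> : phi (mk_dual lL Lb) - phi L' = (phi (mk_dual lL Lb) - L b) +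
  (L b - L' b) - (phi L' - L' b) by ring.
apply: le_lt_trans (rnormD _ _) _; rewrite rnormN.
apply: le_lt_trans (lerD (rnormD _ _) (lexx _)) _.
rewrite -[mk_dual lL Lb b]/(L b) in h2; lra.
Qed.

Theorem weakly_compact_positive : weakly_compact D.
Proof.
have [C C0 pC] := p_bounded.
apply: (@precompact_subset (weak (dual V)) _ (K C)); last first.
  by rewrite precompact_closed; [exact: K_compact|exact: K_closed].
move=> _ [a /= a1 <-] c; rewrite rnorm_le1 in a1.
apply: le_trans (cauchy_schwarz hDl hZl hDr hZr h_ge0 a c) _.
rewrite ler_wpM2r//; apply: le_trans (pC a) _; by rewrite ler_piMr.
Qed.

End weakly_compact_positive.

(** * Integrals and inner products in L^2 *)

Section L2_theory.
Context d (T : measurableType d) (R : realType).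
Variable mu : {measure set T -> \bar R}.
Local Notation H := (L2 mu).
Implicit Types (x y z : H) (f g : T -> R[i]).

Lemma L2_cmeasurable x : cmeasurable x.
Proof. by have [] := L2repr_square_integrable x. Qed.

Lemma L2_ext x y : (x : T -> R[i]) = y %[ae mu] -> x = y.
Proof. by move=> xy; rewrite -[x]reprK -[y]reprK; exact: L2pi_eq. Qed.

Lemma L2_ofE f : square_integrable mu f ->
  (L2_of mu f : T -> R[i]) = f %[ae mu].
Proof.
move=> fi; have fP : f \in l2 mu by apply/asboolP.
rewrite /L2_of; have := L2reprK (insubd (0 : l2fun mu) f).
by rewrite -[l2val (insubd _ _)]/(val _) insubdK.
Qed.

Lemma L2_ae_refl x : (x : T -> R[i]) = (x : T -> R[i]) %[ae mu].
Proof. exact: ae_eq_refl. Qed.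

Lemma L2norm_ae_normc f g : cmeasurable f -> cmeasurable g ->
  {ae mu, forall t, Normc.normc (f t) = Normc.normc (g t)} ->
  L2norm mu f = L2norm mu g.
Proof.
move=> mf mg fg; rewrite /L2norm !Lnorm2E; congr poweR.
have m (h : T -> R[i]) : cmeasurable h ->
    measurable_fun setT (fun t => (`|Normc.normc (h t)| `^ 2)%:E).
  move=> mh; apply/measurable_EFinP.
  apply: (measurableT_comp (measurable_powR _)).
  by apply: measurableT_comp => //; exact: cmeasurable_normc.
apply: ae_eq_integral => //; [exact: m|exact: m|].
by apply: filterS fg => t ft _; rewrite /= ft.
Qed.

Lemma L2_rnorm_ae x f : cmeasurable f -> (x : T -> R[i]) = f %[ae mu] ->
  rnorm x = fine (L2norm mu f).
Proof.
move=> mf xf; rewrite L2_rnormE; congr fine.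
by apply: L2norm_ae => //; exact: L2_cmeasurable.
Qed.

Lemma L2_addE x y : ((x + y : H) : T -> R[i]) = (fun t => x t + y t) %[ae mu].
Proof. exact: L2reprK. Qed.

Lemma L2_scaleE k x : ((k *: x : H) : T -> R[i]) = (fun t => k * x t) %[ae mu].
Proof. exact: L2reprK. Qed.

Definition cintegrable f : Prop :=
  mu.-integrable setT (EFin \o (fun t => complex.Re (f t))) /\
  mu.-integrable setT (EFin \o (fun t => complex.Im (f t))).

Lemma cintegral_ae f g : cmeasurable f -> cmeasurable g -> f = g %[ae mu] ->
  cintegral mu f = cintegral mu g.
Proof.
move=> [fr fi] [gr gi] fg; congr (_ +i* _); rewrite /Rintegral; congr fine;
  apply: ae_eq_integral => //; try exact/measurable_EFinP.
- by apply: filterS fg => t /(_ I) ft _; rewrite ft.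
- by apply: filterS fg => t /(_ I) ft _; rewrite ft.
Qed.

Lemma cintegralD f g : cintegrable f -> cintegrable g ->
  cintegral mu (fun t => f t + g t) = cintegral mu f + cintegral mu g.
Proof.
move=> [fr fi] [gr gi]; rewrite /cintegral.
under [X in X +i* _ = _]eq_Rintegral do rewrite Re_add.
under [X in _ +i* X = _]eq_Rintegral do rewrite Im_add.
by rewrite !RintegralD.
Qed.

Lemma cintegralZ k f : cintegrable f ->
  cintegral mu (fun t => k * f t) = k * cintegral mu f.
Proof.
move=> [fr fi]; rewrite /cintegral; case: k => a b.
have RM t : complex.Re ((a +i* b) * f t) =
  a * complex.Re (f t) - b * complex.Im (f t) by case: (f t).
have IM t : complex.Im ((a +i* b) * f t) =
  a * complex.Im (f t) + b * complex.Re (f t) by case: (f t).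
under [X in X +i* _ = _]eq_Rintegral do rewrite RM.
under [X in _ +i* X = _]eq_Rintegral do rewrite IM.
have Z c (h : T -> R) : mu.-integrable setT (EFin \o h) ->
  mu.-integrable setT (EFin \o (fun t => c * h t)).
  by move=> hi; have := integrableZl measurableT c hi.
by rewrite RintegralB ?RintegralD ?RintegralZl//; exact: Z.
Qed.

Lemma cintegral_conj f : cintegrable f ->
  cintegral mu (fun t => conjc (f t)) = conjc (cintegral mu f).
Proof.
move=> [fr fi]; rewrite /cintegral /=.
congr (_ +i* _); first by apply: eq_Rintegral => t _; case: (f t).
rewrite -[RHS]mulN1r -RintegralZl//.
by apply: eq_Rintegral => t _; rewrite mulN1r; case: (f t).
Qed.

Lemma cintegral_ge0 f : (forall t, 0 <= f t) -> 0 <= cintegral mu f.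
Proof.
move=> f0; have f0' t : 0 <= complex.Re (f t) /\ complex.Im (f t) = 0.
  by have := f0 t; case: (f t) => a b; rewrite lecE/= => /andP[/eqP-> ->].
rewrite lecE/=; apply/andP; split.
  under eq_Rintegral do rewrite (f0' _).2.
  by rewrite Rintegral_cst// mul0r.
by apply: Rintegral_ge0 => t _; case: (f0' t).
Qed.

Lemma cintegral0 : cintegral mu (fun=> 0) = 0.
Proof. by rewrite /cintegral !Rintegral_cst// mul0r. Qed.

Lemma cintegrableD f g : cintegrable f -> cintegrable g ->
  cintegrable (fun t => f t + g t).
Proof.
move=> [fr fi] [gr gi]; split.
  have := integrableD measurableT fr gr; apply: eq_integrable => // t _.
  by rewrite /= Re_add.
have := integrableD measurableT fi gi; apply: eq_integrable => // t _.
by rewrite /= Im_add.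
Qed.

Lemma cintegrableZ k f : cintegrable f -> cintegrable (fun t => k * f t).
Proof.
move=> [fr fi]; case: k => a b; split.
  have := integrableB measurableT (integrableZl measurableT a fr)
    (integrableZl measurableT b fi); apply: eq_integrable => // t _.
  by rewrite /=; case: (f t).
have := integrableD measurableT (integrableZl measurableT a fi)
  (integrableZl measurableT b fr); apply: eq_integrable => // t _.
by rewrite /=; case: (f t).
Qed.

Lemma cintegrable0 : cintegrable (fun=> 0).
Proof. by split; exact: integrable0. Qed.

Lemma cintegral_sum (F : nat -> T -> R[i]) n :
  (forall i, cintegrable (F i)) ->
  cintegrable (fun t => \sum_(0 <= i < n) F i t) /\
  cintegral mu (fun t => \sum_(0 <= i < n) F i t) =
    \sum_(0 <= i < n) cintegral mu (F i).
Proof.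
move=> Fi; elim: n => [|n [IHi IHn]].
  rewrite big_geq//; under eq_fun do rewrite big_geq//.
  by split; [exact: cintegrable0|exact: cintegral0].
rewrite big_nat_recr//= -IHn; under eq_fun do rewrite big_nat_recr//=.
by split; [exact: cintegrableD|exact: cintegralD].
Qed.

Lemma inner_integrable x y : cintegrable (fun t => x t * conjc (y t)).
Proof.
have [mx my] := (L2_cmeasurable x, L2_cmeasurable y).
have mnx := cmeasurable_normc mx; have mny := cmeasurable_normc my.
pose k t := Normc.normc (x t) * Normc.normc (y t).
have mk : measurable_fun setT k by exact: measurable_funM.
have k0 t : 0 <= k t by rewrite mulr_ge0 ?normc_ge0.
have ki : mu.-integrable setT (EFin \o k).
  apply/integrableP; split; first exact/measurable_EFinP.
  have two0 : 0 < 2 :> R by [].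
  have half2 : 2^-1 + 2^-1 = 1 :> R by rewrite -div1r -splitr.
  have := @hoelder _ _ _ mu _ _ 2 2 mnx mny two0 two0 half2.
  rewrite Lnorm1 => hle; apply: le_lt_trans hle _.
  by rewrite -ge0_fin_numE ?mule_ge0 ?Lnorm_ge0// fin_numM// L2norm_fin_num//;
    exact: L2repr_square_integrable.
have [mr mi] := cmeasurableM mx (cmeasurable_conjc my).
split; apply: (le_integrable measurableT _ _ ki) => //.
- exact/measurable_EFinP.
- move=> t _; rewrite lee_fin [leRHS]ger0_norm// /k -(normc_conjc (y t)).
  by rewrite -Normc.normcM Re_le_normc.
- exact/measurable_EFinP.
- move=> t _; rewrite lee_fin [leRHS]ger0_norm// /k -(normc_conjc (y t)).
  by rewrite -Normc.normcM Im_le_normc.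
Qed.

Lemma inner_ae x y f g : cmeasurable f -> cmeasurable g ->
  (x : T -> R[i]) = f %[ae mu] -> (y : T -> R[i]) = g %[ae mu] ->
  inner x y = cintegral mu (fun t => f t * conjc (g t)).
Proof.
move=> mf mg xf yg; apply: cintegral_ae.
- by apply: cmeasurableM; [|apply: cmeasurable_conjc]; exact: L2_cmeasurable.
- by apply: cmeasurableM => //; exact: cmeasurable_conjc.
by apply: filterS2 xf yg => t /(_ I) xt /(_ I) yt _; rewrite xt yt.
Qed.

Lemma innerDl x y z : inner (x + y) z = inner x z + inner y z.
Proof.
have [mx my] := (L2_cmeasurable x, L2_cmeasurable y).
rewrite (inner_ae _ _ (L2_addE x y) (L2_ae_refl z)); last 2 first.
- exact: cmeasurableD.
- exact: L2_cmeasurable.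
under eq_fun do rewrite mulrDl.
by rewrite cintegralD//; exact: inner_integrable.
Qed.

Lemma innerZl k x z : inner (k *: x) z = k * inner x z.
Proof.
have mx := L2_cmeasurable x.
rewrite (inner_ae _ _ (L2_scaleE k x) (L2_ae_refl z)); last 2 first.
- exact: cmeasurableZ.
- exact: L2_cmeasurable.
under eq_fun do rewrite -mulrA.
by rewrite cintegralZ//; exact: inner_integrable.
Qed.

Lemma inner_conj x y : inner y x = conjc (inner x y).
Proof.
rewrite /inner -cintegral_conj; last exact: inner_integrable.
by congr cintegral; apply/funext => t; rewrite rmorphM/= conjcK mulrC.
Qed.

Lemma innerZr k x z : inner z (k *: x) = conjc k * inner z x.
Proof. by rewrite inner_conj innerZl conjcM -inner_conj. Qed.

Lemma inner_ge0 x : 0 <= inner x x.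
Proof.
apply: cintegral_ge0 => t; case: (x t) => a b.
rewrite lecE/=; apply/andP; split; first by apply/eqP; ring.
by rewrite mulrN opprK -!expr2 addr_ge0 ?sqr_ge0.
Qed.

Lemma inner0l z : inner 0 z = 0.
Proof. by rewrite -(scale0r 0) innerZl mul0r. Qed.

Lemma inner_suml n (F : nat -> H) z :
  inner (\sum_(0 <= i < n) F i) z = \sum_(0 <= i < n) inner (F i) z.
Proof.
apply: (big_morph (fun x => inner x z)) => [x y|]; first exact: innerDl.
exact: inner0l.
Qed.

Lemma inner_sumr n (F : nat -> H) z :
  inner z (\sum_(0 <= i < n) F i) = \sum_(0 <= i < n) inner z (F i).
Proof.
rewrite inner_conj inner_suml (big_morph (@conjc R) (@conjcD R) (conjc0 R)).
by apply: eq_bigr => i _; rewrite -inner_conj.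
Qed.

(** The sum is the squared Hilbert-Schmidt norm of sum_i x_i (x) y_i.
    Integrating out only one variable of its kernel
    sum_i x_i(s) conj (y_i(t)) shows it as the integral over t of the squared
    norm of sum_i conj (y_i(t)) x_i. *)
Lemma hilbert_schmidt_ge0 (x y : nat -> H) n :
  0 <= \sum_(0 <= i < n) \sum_(0 <= j < n)
         inner (x i) (x j) * inner (y j) (y i).
Proof.
pose F i j t := inner (x i) (x j) * (y j t * conjc (y i t)).
have Fi i j : cintegrable (F i j).
  by apply: cintegrableZ; exact: inner_integrable.
rewrite (_ : \sum_(0 <= i < n) _ =
    cintegral mu (fun t => \sum_(0 <= i < n) \sum_(0 <= j < n) F i j t)).
  apply: cintegral_ge0 => t.
  rewrite (_ : \sum_(0 <= i < n) _ =
    inner (\sum_(0 <= i < n) conjc (y i t) *: x i)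
          (\sum_(0 <= i < n) conjc (y i t) *: x i)); first exact: inner_ge0.
  rewrite inner_suml; apply: eq_bigr => i _.
  rewrite inner_sumr; apply: eq_bigr => j _.
  by rewrite innerZl innerZr conjcK /F; ring.
have FFi i : cintegrable (fun t => \sum_(0 <= j < n) F i j t).
  by have [] := cintegral_sum n (Fi i).
rewrite (cintegral_sum n FFi).2; apply: eq_bigr => i _.
rewrite (cintegral_sum n (Fi i)).2; apply: eq_bigr => j _.
by rewrite cintegralZ//; exact: inner_integrable.
Qed.

End L2_theory.

(** * Reflection invariance of dt/|t| *)

Section haar_reflection.
Context (R : realType).
Local Notation mu := (@haar R).

Lemma haarN (A : set R) : measurable A -> mu (-%R @^-1` A) = mu A.
Proof.
move=> mA; rewrite /haar.
have mopp : measurable_fun setT (-%R : R -> measurableTypeR R).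
  exact: oppr_measurable.
transitivity (\int[pushforward lebesgue_measure
    (-%R : R -> measurableTypeR R)]_(t in A) (`|t|^-1)%:E)%E; last first.
  by apply: eq_measure_integral => B mB _; exact: lebesgue_measureN.
rewrite ge0_integral_pushforward//.
- by apply: eq_integral => t _ /=; rewrite normrN.
- apply/measurable_EFinP; rewrite (_ : (fun t => _) = (fun t => `|t| `^ (-1))).
    apply: measurable_funTS.
    by apply: (measurableT_comp (measurable_powR _)).
  by apply/funext => t; rewrite powR_inv1.
Qed.

Let mopp : measurable_fun setT (-%R : R -> R).
Proof. exact: oppr_measurable. Qed.

Lemma ge0_integral_haarN (f : R -> \bar R) : measurable_fun setT f ->
  (forall t, 0 <= f t)%E -> (\int[mu]_t f (- t)%R = \int[mu]_t f t)%E.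
Proof.
move=> mf f0.
transitivity (\int[pushforward mu (-%R : R -> R)]_t f t)%E.
  by rewrite ge0_integral_pushforward.
by apply: eq_measure_integral => B mB _; exact: haarN.
Qed.

Lemma Rintegral_haarN (f : R -> R) : measurable_fun setT f ->
  \int[mu]_t f (- t) = \int[mu]_t f t.
Proof.
move=> mf; rewrite /Rintegral; congr fine.
have mEf : measurable_fun setT (EFin \o f) by exact/measurable_EFinP.
rewrite integralE [RHS]integralE; congr (_ - _)%E.
  have := ge0_integral_haarN (measurable_funepos mEf) (funepos_ge0 _).
  by move=> <-; apply: eq_integral => t _; rewrite !funeposE.
have := ge0_integral_haarN (measurable_funeneg mEf) (funeneg_ge0 _).
by move=> <-; apply: eq_integral => t _; rewrite !funenegE.
Qed.

Lemma cmeasurableN (f : R -> R[i]) : cmeasurable f ->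
  cmeasurable (fun t : R => f (- t)).
Proof.
move=> [fr fi]; split.
  exact: (measurableT_comp fr mopp).
exact: (measurableT_comp fi mopp).
Qed.

Lemma cintegral_haarN (f : R -> R[i]) : cmeasurable f ->
  cintegral mu (fun t : R => f (- t)) = cintegral mu f.
Proof.
move=> [fr fi]; congr (_ +i* _).
  exact: (Rintegral_haarN fr).
exact: (Rintegral_haarN fi).
Qed.

Lemma L2norm_haarN (f : R -> R[i]) : cmeasurable f ->
  L2norm mu (fun t : R => f (- t)) = L2norm mu f.
Proof.
move=> mf; rewrite /L2norm !Lnorm2E; congr poweR.
have m : measurable_fun setT (fun t => (`|Normc.normc (f t)| `^ 2)%:E).
  apply/measurable_EFinP; apply: (measurableT_comp (measurable_powR _)).
  by apply: measurableT_comp => //; exact: cmeasurable_normc.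
by rewrite -(ge0_integral_haarN m)// => t; rewrite lee_fin powR_ge0.
Qed.

Lemma haar_aeN (f g : R -> R[i]) : f = g %[ae mu] ->
  (fun t : R => f (- t)) = (fun t : R => g (- t)) %[ae mu].
Proof.
move=> [N [mN N0 fgN]]; exists (-%R @^-1` N); split.
- by rewrite -[X in measurable X]setTI; exact: mopp.
- by rewrite haarN.
by move=> t h; apply: fgN => /= ht; apply: h => _; exact: ht.
Qed.

Lemma haar_neq0 : {ae mu, forall t : R, t != 0}.
Proof.
exists [set 0]; split => //.
  by rewrite /= /haar integral_set1.
by move=> t /=; case: eqVneq => // ->.
Qed.

End haar_reflection.

(** * Sign, reflection and conjugation *)

Section operators.
Context (R : realType).
Local Notation mu := (@haar R).
Local Notation H := (L2 (@haar R)).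
Implicit Types x y : H.

Let sgn (t : R) : R := t / `|t|.

Let sgnN t : sgn (- t) = - sgn t.
Proof. by rewrite /sgn normrN mulNr. Qed.

Let sgn2 t : t != 0 -> (sgn t)%:C * (sgn t)%:C = 1.
Proof.
move=> t0; rewrite -rmorphM /sgn/= mulf_div -normrM -!expr2.
by rewrite ger0_norm ?sqr_ge0// divff// sqrf_eq0.
Qed.

Let measurable_sgn : measurable_fun setT sgn.
Proof.
apply: measurable_funM => //.
rewrite (_ : (fun t => _) = (fun t => `|t| `^ (-1))).
  by apply: (measurableT_comp (measurable_powR _)).
by apply/funext => t; rewrite powR_inv1.
Qed.

Let cmeasurable_sgn : cmeasurable (fun t => (sgn t)%:C).
Proof. by split => //; exact: measurable_cst. Qed.

Lemma flip_opE x : (flip_op x : R -> R[i]) = (fun t : R => x (- t)) %[ae mu].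
Proof.
apply: L2_ofE; have [mx xoo] := L2repr_square_integrable x.
by split; [exact: cmeasurableN|rewrite L2norm_haarN].
Qed.

Lemma conj_opE x : (conj_op x : R -> R[i]) = (fun t => conjc (x t)) %[ae mu].
Proof.
apply: L2_ofE; have [mx xoo] := L2repr_square_integrable x.
split; first exact: cmeasurable_conjc.
by rewrite /L2norm; under eq_fun do rewrite normc_conjc.
Qed.

Let normc_sgn t z : t != 0 -> Normc.normc ((sgn t)%:C * z) = Normc.normc z.
Proof.
move=> t0; rewrite Normc.normcM normc_real /sgn normrM normfV normr_id.
by rewrite divff ?normr_eq0// mul1r.
Qed.

Let L2norm_sgn x : L2norm mu (fun t => (sgn t)%:C * x t) = L2norm mu x.
Proof.
have mx := L2_cmeasurable x; apply: L2norm_ae_normc => //.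
  exact: cmeasurableM.
by apply: filterS (haar_neq0 R) => t; exact: normc_sgn.
Qed.

Lemma sgn_opE x :
  (sgn_op x : R -> R[i]) = (fun t => (sgn t)%:C * x t) %[ae mu].
Proof.
apply: L2_ofE; have [mx xoo] := L2repr_square_integrable x.
by split; [exact: cmeasurableM|rewrite L2norm_sgn].
Qed.

Let ae_and (P Q : R -> Prop) : {ae mu, forall t, P t} ->
  {ae mu, forall t, Q t} -> {ae mu, forall t, P t /\ Q t}.
Proof. by move=> p q; apply: filterS2 p q. Qed.

Lemma flip_opK : involutive (@flip_op R).
Proof.
move=> x; apply: L2_ext.
apply: filterS2 (flip_opE (flip_op x)) (haar_aeN (flip_opE x)).
by move=> t /(_ I) -> /(_ I) -> _; rewrite opprK.
Qed.

Lemma conj_opK : involutive (@conj_op R).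
Proof.
move=> x; apply: L2_ext.
apply: filterS2 (conj_opE (conj_op x)) (conj_opE x).
by move=> t /(_ I) -> /(_ I) -> _; rewrite conjcK.
Qed.

Lemma sgn_opK : involutive (@sgn_op R).
Proof.
move=> x; apply: L2_ext.
apply: filterS3 (sgn_opE (sgn_op x)) (sgn_opE x) (haar_neq0 R).
by move=> t /(_ I) -> /(_ I) -> t0 _; rewrite mulrA sgn2// mul1r.
Qed.

Lemma conj_flip_op x : conj_op (flip_op x) = flip_op (conj_op x).
Proof.
apply: L2_ext.
have h := ae_and (flip_opE (conj_op x)) (haar_aeN (conj_opE x)).
apply: filterS3 (conj_opE (flip_op x)) (flip_opE x) h.
by move=> t /(_ I) -> /(_ I) -> [/(_ I) -> /(_ I) ->] _.
Qed.

Lemma flip_opD x y : flip_op (x + y) = flip_op x + flip_op y.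
Proof.
apply: L2_ext.
have h2 := ae_and (flip_opE (x + y)) (haar_aeN (L2_addE x y)).
have h1 := ae_and (flip_opE x) (flip_opE y).
apply: filterS3 ((L2_addE (flip_op x) (flip_op y))) h1 h2.
by move=> t /(_ I) -> [/(_ I) -> /(_ I) ->] [/(_ I) -> /(_ I) ->] _.
Qed.

Lemma conj_opD x y : conj_op (x + y) = conj_op x + conj_op y.
Proof.
apply: L2_ext.
have h2 := ae_and (conj_opE (x + y)) (L2_addE x y).
have h1 := ae_and (conj_opE x) (conj_opE y).
apply: filterS3 ((L2_addE (conj_op x) (conj_op y))) h1 h2.
by move=> t /(_ I) -> [/(_ I) -> /(_ I) ->] [/(_ I) -> /(_ I) ->] _;
  rewrite conjcD.
Qed.

Lemma sgn_opD x y : sgn_op (x + y) = sgn_op x + sgn_op y.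
Proof.
apply: L2_ext.
have h2 := ae_and (sgn_opE (x + y)) (L2_addE x y).
have h1 := ae_and (sgn_opE x) (sgn_opE y).
apply: filterS3 ((L2_addE (sgn_op x) (sgn_op y))) h1 h2.
by move=> t /(_ I) -> [/(_ I) -> /(_ I) ->] [/(_ I) -> /(_ I) ->] _;
  rewrite mulrDr.
Qed.

Lemma flip_opZ k x : flip_op (k *: x) = k *: flip_op x.
Proof.
apply: L2_ext.
have h := ae_and (flip_opE (k *: x)) (haar_aeN (L2_scaleE k x)).
apply: filterS3 (L2_scaleE k (flip_op x)) (flip_opE x) h.
by move=> t /(_ I) -> /(_ I) -> [/(_ I) -> /(_ I) ->] _.
Qed.

Lemma conj_opZ k x : conj_op (k *: x) = conjc k *: conj_op x.
Proof.
apply: L2_ext.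
have h := ae_and (conj_opE (k *: x)) (L2_scaleE k x).
apply: filterS3 (L2_scaleE (conjc k) (conj_op x)) (conj_opE x) h.
by move=> t /(_ I) -> /(_ I) -> [/(_ I) -> /(_ I) ->] _; rewrite conjcM.
Qed.

Lemma sgn_opZ k x : sgn_op (k *: x) = k *: sgn_op x.
Proof.
apply: L2_ext.
have h := ae_and (sgn_opE (k *: x)) (L2_scaleE k x).
apply: filterS3 (L2_scaleE k (sgn_op x)) (sgn_opE x) h.
by move=> t /(_ I) -> /(_ I) -> [/(_ I) -> /(_ I) ->] _; rewrite mulrCA.
Qed.

Lemma rnorm_flip_op x : rnorm (flip_op x) = rnorm x.
Proof.
have mx := L2_cmeasurable x.
by rewrite (L2_rnorm_ae (cmeasurableN mx) (flip_opE x)) L2norm_haarN.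
Qed.

Lemma rnorm_conj_op x : rnorm (conj_op x) = rnorm x.
Proof.
have mx := L2_cmeasurable x.
rewrite (L2_rnorm_ae (cmeasurable_conjc mx) (conj_opE x)) L2_rnormE /L2norm.
by under eq_fun do rewrite normc_conjc.
Qed.

Lemma rnorm_sgn_op x : rnorm (sgn_op x) = rnorm x.
Proof.
have mx := L2_cmeasurable x.
rewrite (L2_rnorm_ae (cmeasurableM cmeasurable_sgn mx) (sgn_opE x)).
by rewrite L2norm_sgn.
Qed.

Lemma inner_sgn_op x y : inner (sgn_op x) (sgn_op y) = inner x y.
Proof.
have [mx my] := (L2_cmeasurable x, L2_cmeasurable y).
rewrite (inner_ae _ _ (sgn_opE x) (sgn_opE y)); try exact: cmeasurableM.
apply: cintegral_ae.
- apply: cmeasurableM; first exact: cmeasurableM.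
  by apply: cmeasurable_conjc; exact: cmeasurableM.
- by apply: cmeasurableM => //; exact: cmeasurable_conjc.
apply: filterS (haar_neq0 R) => t t0 _.
by rewrite conjcM conjc_real mulrACA sgn2// mul1r.
Qed.

(** The form is the integral of sgn(t) x(t) y(-t); reflection exchanges x and y
    and changes the sign, because sgn is odd. *)
Lemma inner_sgn_flip_conj x y :
  inner (sgn_op x) (flip_op (conj_op y)) =
  - inner (sgn_op y) (flip_op (conj_op x)).
Proof.
have form_E (u v : H) : inner (sgn_op u) (flip_op (conj_op v)) =
    cintegral mu (fun t : R => (sgn t)%:C * u t * v (- t)).
  have [mu_ mv] := (L2_cmeasurable u, L2_cmeasurable v).
  rewrite -conj_flip_op.
  rewrite (inner_ae (cmeasurableM cmeasurable_sgn mu_)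
    (cmeasurable_conjc (cmeasurableN mv)) (sgn_opE u) (f := _)).
    by under eq_fun do rewrite conjcK.
  apply: filterS2 (conj_opE (flip_op v)) (flip_opE v).
  by move=> t /(_ I) -> /(_ I) ->.
have [mx my] := (L2_cmeasurable x, L2_cmeasurable y).
have m u v : cmeasurable (u : H) -> cmeasurable (v : H) ->
    cmeasurable (fun t : R => (sgn t)%:C * u t * v (- t)).
  move=> mu_ mv; apply: cmeasurableM (cmeasurableN mv).
  exact: cmeasurableM.
have mNy := L2_cmeasurable (-1 *: y).
rewrite -mulN1r -innerZl -sgn_opZ !form_E -cintegral_haarN; last exact: m.
apply: cintegral_ae; [exact: (cmeasurableN (m _ _ mx my))|exact: m|].
apply: filterS (L2_scaleE (-1) y) => t /(_ I) -> _.
by rewrite opprK sgnN rmorphN/=; ring.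
Qed.

Lemma inner_flip_conj x y :
  inner (flip_op (conj_op x)) y = inner (flip_op (conj_op y)) x.
Proof.
have form_E (u v : H) : inner (flip_op (conj_op u)) v =
    cintegral mu (fun t : R => conjc (u (- t)) * conjc (v t)).
  have [mu_ mv] := (L2_cmeasurable u, L2_cmeasurable v).
  rewrite -conj_flip_op.
  apply: (inner_ae (cmeasurable_conjc (cmeasurableN mu_)) mv).
    apply: filterS2 (conj_opE (flip_op u)) (flip_opE u).
    by move=> t /(_ I) -> /(_ I) ->.
  exact: L2_ae_refl.
have [mx my] := (L2_cmeasurable x, L2_cmeasurable y).
rewrite !form_E -[RHS]cintegral_haarN.
  by congr cintegral; apply/funext => t; rewrite opprK mulrC.
by apply: cmeasurableM; apply: cmeasurable_conjc => //; exact: cmeasurableN.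
Qed.

End operators.

(** * Density of the finite-rank operators *)

Section trace_class_density.
Context d (T : measurableType d) (R : realType).
Variable mu : {measure set T -> \bar R}.
Local Notation H := (L2 mu).
Implicit Types (a b : trace_class mu) (x y : nat -> H).

Lemma series_shift (V : zmodType) (u : nat -> V) n k :
  series (fun i => u (n + i)%N) k = series u (k + n)%N - series u n.
Proof.
rewrite !seriesEnat/= [X in _ = X - _](@big_cat_nat _ _ _ n)//= ?leq_addl//.
rewrite [RHS]addrC addKr -{2}[n]add0n big_addn addnK.
by apply: eq_bigr => i _; rewrite addnC.
Qed.

Lemma tc_sumE x y n z :
  tc_val (\sum_(0 <= i < n) tensor (x i) (y i)) z =
  \sum_(0 <= i < n) rank_one (x i) (y i) z.
Proof.
elim: n => [|n IHn]; first by rewrite !big_geq.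
by rewrite !big_nat_recr//= -IHn.
Qed.

(** Dropping the first terms of a representation represents the remainder, so
    the partial sums converge in the trace norm. *)
Lemma cvg_partial_tensors a x y s : represents x y a s ->
  series (fun n => tensor (x n) (y n)) @ \oo --> a.
Proof.
move=> [xys xya]; apply/cvg_rnormP => e e0.
move/cvgrPdist_lt/(_ _ e0) : (xys); apply: filterS => n.
move=> /(le_lt_trans (ler_norm _)); apply: le_lt_trans.
apply: (trace_rnorm_le (x := fun i => x (n + i)%N) (y := fun i => y (n + i)%N)).
split.
  pose u i := rnorm (x i) * rnorm (y i).
  rewrite (_ : series _ = (fun k => series u (k + n)%N - series u n)).
    by apply: cvgB; [rewrite cvg_shiftn|exact: cvg_cst].
  by apply/funext => k; rewrite (series_shift u).
move=> z; pose u i := rank_one (x i) (y i) z.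
rewrite (_ : series _ = (fun k => series u (k + n)%N - series u n)); last first.
  by apply/funext => k; rewrite (series_shift u).
rewrite -[X in _ --> X]/(a z - tc_val (series _ n) z) seriesEnat tc_sumE.
apply: cvgB; last exact: cvg_cst.
by rewrite cvg_shiftn; exact: xya.
Qed.

Lemma cvg_partial_tensors_ex a : exists x y,
  series (fun n => tensor (x n) (y n)) @ \oo --> a.
Proof.
have /asboolP[x [y [s xya]]] := tc_valP a.
by exists x, y; exact: cvg_partial_tensors xya.
Qed.

Lemma dual_tensor_ext (f g : dual (trace_class mu)) :
  (forall x y : H, f (tensor x y) = g (tensor x y)) -> forall a, f a = g a.
Proof.
move=> fg a; have [x [y xya]] := cvg_partial_tensors_ex a.
pose S := series (fun n => tensor (x n) (y n)).
have fS (h : dual (trace_class mu)) : (h : _ -> R[i]) \o S @ \oo --> h a.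
  by apply: continuous_cvg => //; exact: dual_continuous.
have fgS : (f : _ -> R[i]) \o S = (g : _ -> R[i]) \o S.
  apply/funext => n; rewrite /= /S seriesEnat/= !dual_sum.
  by apply: eq_bigr => i _; exact: fg.
apply: (@cvg_unique _ _ (((f : _ -> R[i]) \o S) @ \oo)) => //; first exact: fS.
by rewrite fgS; exact: fS.
Qed.

End trace_class_density.

(** * Conjugating trace-class operators by antilinear isometries *)

Section conjugation.
Context d (T : measurableType d) (R : realType).
Variable mu : {measure set T -> \bar R}.
Local Notation H := (L2 mu).
Variables (U W : H -> H).
Hypothesis UD : forall x y, U (x + y) = U x + U y.
Hypothesis UZ : forall k x, U (k *: x) = conjc k *: U x.
Hypothesis U_norm : forall x, rnorm (U x) = rnorm x.
Hypothesis W_norm : forall x, rnorm (W x) = rnorm x.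
Hypothesis W_adj : forall x y, inner (W x) y = conjc (inner x (W y)).

Let UN x : U (- x) = - U x.
Proof.
by rewrite -scaleN1r UZ (_ : conjc (-1) = -1) ?scaleN1r// rmorphN1.
Qed.

(** U turns the series for a at W z into the one for U a W at z: as W_adj says
    that W is antilinearly self-adjoint, <W z, y> x goes to <z, W y> U x. *)
Lemma conjugate_represents x y a s : represents x y a s ->
  represents (U \o x) (W \o y) (U \o a \o W) s.
Proof.
move=> [xys xya]; split.
  rewrite (_ : (fun n => _) = (fun n => rnorm (x n) * rnorm (y n)))//.
  by apply/funext => n; rewrite /= U_norm W_norm.
move=> z; apply/cvg_rnormP => e e0.
have /cvg_rnormP/(_ _ e0) := xya (W z); apply: filterS => n.
rewrite (_ : series (fun n => rank_one ((U \o x) n) ((W \o y) n) z) n =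
    U (series (fun n => rank_one (x n) (y n) (W z)) n)).
  by rewrite /= -UN -UD U_norm.
have U0 : U 0 = 0 by rewrite -[0](scale0r 0) UZ conjc0 !scale0r.
rewrite !seriesEnat/= (big_morph U UD U0); apply: eq_bigr => i _.
by rewrite /rank_one UZ W_adj conjcK.
Qed.

Lemma conjugate_trace_class (a : trace_class mu) :
  (U \o a \o W) \in @is_trace_class _ _ _ mu.
Proof.
have /asboolP[x [y [s xya]]] := tc_valP a; apply/asboolP.
by exists (U \o x), (W \o y), s; exact: conjugate_represents.
Qed.

Definition tc_conjugate (a : trace_class mu) : trace_class mu :=
  TraceClass (conjugate_trace_class a).

Lemma tc_conjugateD a b :
  tc_conjugate (a + b) = tc_conjugate a + tc_conjugate b.
Proof. by apply/val_inj/funext => z; exact: UD. Qed.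

Lemma tc_conjugateZ k a : tc_conjugate (k *: a) = conjc k *: tc_conjugate a.
Proof. by apply/val_inj/funext => z; exact: UZ. Qed.

Lemma tc_conjugate_tensor x y : tc_conjugate (tensor x y) = tensor (U x) (W y).
Proof.
by apply/val_inj/funext => z /=; rewrite /rank_one UZ W_adj conjcK.
Qed.

Lemma rnorm_tc_conjugate_le a : rnorm (tc_conjugate a) <= rnorm a.
Proof.
apply: lb_le_inf; first by have [] := trace_has_inf a.
move=> s [x [y xya]].
exact: (trace_rnorm_le (a := tc_conjugate a) (conjugate_represents xya)).
Qed.

End conjugation.

(** * The antilinear isometry that reduces D to the Hilbert-Schmidt form *)

Section twist.
Context (R : realType).
Local Notation H := (L2 (@haar R)).
Local Notation A := (trace_class (@haar R)).
Implicit Types x y : H.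

Let U x : H := conj_op (flip_op (sgn_op x)).
Let V x : H := sgn_op (flip_op (conj_op x)).
Let W x : H := flip_op (conj_op x).

Let UD x y : U (x + y) = U x + U y.
Proof. by rewrite /U sgn_opD flip_opD conj_opD. Qed.
Let UZ k x : U (k *: x) = conjc k *: U x.
Proof. by rewrite /U sgn_opZ flip_opZ conj_opZ. Qed.
Let U_norm x : rnorm (U x) = rnorm x.
Proof. by rewrite /U rnorm_conj_op rnorm_flip_op rnorm_sgn_op. Qed.
Let VD x y : V (x + y) = V x + V y.
Proof. by rewrite /V conj_opD flip_opD sgn_opD. Qed.
Let VZ k x : V (k *: x) = conjc k *: V x.
Proof. by rewrite /V conj_opZ flip_opZ sgn_opZ. Qed.
Let V_norm x : rnorm (V x) = rnorm x.
Proof. by rewrite /V rnorm_sgn_op rnorm_flip_op rnorm_conj_op. Qed.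
Let W_norm x : rnorm (W x) = rnorm x.
Proof. by rewrite /W rnorm_flip_op rnorm_conj_op. Qed.

Let W_adj x y : inner (W x) y = conjc (inner x (W y)).
Proof. by rewrite /W inner_flip_conj inner_conj. Qed.

Let UVK x : U (V x) = x.
Proof. by rewrite /U /V sgn_opK flip_opK conj_opK. Qed.
Let VUK x : V (U x) = x.
Proof. by rewrite /U /V conj_opK flip_opK sgn_opK. Qed.
Let WK x : W (W x) = x.
Proof. by rewrite /W conj_flip_op flip_opK conj_opK. Qed.

(** U and W are solved from R conj U = S and R conj W = id, so that the second
    argument of D, once twisted, enters the formula for D as S x and y. *)
Definition twist : A -> A := tc_conjugate UD UZ U_norm W_norm W_adj.
Let untwist : A -> A := tc_conjugate VD VZ V_norm W_norm W_adj.

Let untwistK a : twist (untwist a) = a.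
Proof.
by apply/val_inj/funext => z; rewrite -[LHS]/(U (V (a (W (W z))))) UVK WK.
Qed.

Let twistK a : untwist (twist a) = a.
Proof.
by apply/val_inj/funext => z; rewrite -[LHS]/(V (U (a (W (W z))))) VUK WK.
Qed.

Lemma rnorm_twist a : rnorm (twist a) = rnorm a.
Proof.
apply/eqP; rewrite eq_le rnorm_tc_conjugate_le/= -{1}(twistK a).
exact: rnorm_tc_conjugate_le.
Qed.

Lemma twistD a b : twist (a + b) = twist a + twist b.
Proof. exact: tc_conjugateD. Qed.

Lemma twistZ k a : twist (k *: a) = conjc k *: twist a.
Proof. exact: tc_conjugateZ. Qed.

Lemma twist_surj b : exists a, twist a = b.
Proof. by exists (untwist b); exact: untwistK. Qed.

Lemma twist_tensor x y : twist (tensor x y) =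
  tensor (conj_op (flip_op (sgn_op x))) (flip_op (conj_op y)).
Proof. exact: tc_conjugate_tensor. Qed.

End twist.

(** * The map D *)

Section cyclic_weakly_compact.
Context (R : realType).
Local Notation H := (L2 (@haar R)).
Local Notation A := (trace_class (@haar R)).
Variable D : {linear A -> dual A}.
Hypothesis D_cont : continuous D.
Hypothesis D_tensor : forall xi1 eta1 xi0 eta0 : H,
  D (tensor xi1 eta1) (tensor xi0 eta0) =
    inner (sgn_op xi1) (flip_op (conj_op xi0)) *
    inner (flip_op (conj_op eta0)) eta1.

Let D_sum (F : nat -> A) n b :
  D (\sum_(0 <= i < n) F i) b = \sum_(0 <= i < n) D (F i) b.
Proof.
apply: (big_morph (fun a => D a b)) => [x y|]; first by rewrite linearD.
by rewrite linear0.
Qed.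

Lemma D_twist_tensor (x y x' y' : H) :
  D (tensor x y) (twist (tensor x' y')) = inner x x' * inner y' y.
Proof.
rewrite twist_tensor D_tensor conj_opK flip_opK inner_sgn_op.
by rewrite conj_flip_op conj_opK flip_opK.
Qed.

Lemma D_twist_ge0 a : 0 <= D a (twist a).
Proof.
have [x [y xya]] := cvg_partial_tensors_ex a.
pose t n := tensor (x n) (y n).
have twist0 : twist (0 : A) = 0.
  by rewrite -[0](scale0r 0) twistZ conjc0 !scale0r.
have twist_sum n : twist (series t n) = \sum_(0 <= i < n) twist (t i).
  by rewrite seriesEnat/= (big_morph (@twist R) (@twistD R) twist0).
apply: (@cvg_ge0 _ (fun n => D (series t n) (twist (series t n)))).
  move=> n; rewrite twist_sum seriesEnat/= (D_sum t).
  rewrite (_ : \sum_(0 <= i < n) _ = \sum_(0 <= i < n) \sum_(0 <= j < n)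
      inner (x i) (x j) * inner (y j) (y i)); first exact: hilbert_schmidt_ge0.
  apply: eq_bigr => i _; rewrite (dual_sum (D (t i)) (fun j => twist (t j))).
  by apply: eq_bigr => j _; exact: D_twist_tensor.
apply: cvg_dual_pair; first by apply: continuous_cvg => //; exact: D_cont.
apply/cvg_rnormP => e e0; move/cvg_rnormP/(_ _ e0) : xya.
apply: filterS => n; rewrite -rnorm_twist.
by rewrite -scaleN1r twistD twistZ (_ : conjc (-1) = -1) ?scaleN1r// rmorphN1.
Qed.

Lemma D_weakly_compact : weakly_compact D.
Proof.
apply: (@weakly_compact_positive _ _ D (@twist R)) => //.
- exact: twistD.
- exact: twistZ.
- exact: rnorm_twist.
- exact: twist_surj.
- exact: D_twist_ge0.
Qed.

Lemma D_antisymmetric a b : D a b = - D b a.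
Proof.
have [N N0 DN] := linear_bound D_cont.
have lDb c : scalar (fun b => - D b c).
  by move=> k u v; rewrite linearP -[_ c]/(k * D u c + D v c) opprD mulrN.
have bDb c b' : rnorm (- D b' c : R[i]) <= N * rnorm c * rnorm b'.
  rewrite rnormN mulrAC; apply: le_trans (dual_le _ _) _.
  by rewrite ler_wpM2r ?rnorm_ge0.
(* Density is used for one argument at a time. *)
have tens (x y : H) c : D (tensor x y) c = - D c (tensor x y).
  apply: (dual_tensor_ext (f := D (tensor x y))
    (g := mk_dual (@lDb (tensor x y)) (@bDb (tensor x y)))) => x' y' /=.
  by rewrite !D_tensor inner_sgn_flip_conj mulNr (inner_flip_conj y').
apply: (dual_tensor_ext (f := D a) (g := mk_dual (@lDb a) (@bDb a))) => x y /=.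
by rewrite tens opprK.
Qed.

End cyclic_weakly_compact.

Theorem proposition4p2 (R : realType)
    (D : {linear dconv_algebra R -> dual (dconv_algebra R)})
    (D_bounded : continuous D)
    (D_tensor : forall xi1 eta1 xi0 eta0 : L2 (@haar R),
      D (tensor xi1 eta1) (tensor xi0 eta0) =
        inner (sgn_op xi1) (flip_op (conj_op xi0)) *
        inner (flip_op (conj_op eta0)) eta1) :
  cyclic D /\ weakly_compact D.
Proof.
split; last exact: (D_weakly_compact D_bounded D_tensor).
exact: (D_antisymmetric D_bounded D_tensor).
Qed.
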